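(* Let $n$ be a positive integer and let $f$ and $g$ be two generic quadratic forms in $E_n$. (a) If $n$ is odd and equal to $2k+1$, then $$\dim\big((E_{2k+1}/(f,g))_{k+1}\big)=a(2k+1,k+1)=1\quad\text{and}\quad \dim\big((E_{2k+1}/(f,g))_{k+2}\big)=a(2k+1,k+2)=0.$$ (b) If $n$ is even and equal to $2k$, then $$\dim\big((E_{2k}/(f,g))_{k}\big)=a(2k,k)=2^k\quad\text{and}\quad \dim\big((E_{2k}/(f,g))_{k+1}\big)=a(2k,k+1)=0.$$
   Context: $E_n$ is the exterior algebra over $\mathbb{C}$ on generators $x_1,\ldots,x_n$ of degree one; $(A)_s$ denotes the $s$-th graded component of a graded algebra $A$, and dimensions are over $\mathbb{C}$. Forms are called generic if all their coefficients (of both forms, taken together) are mutually algebraically independent over $\mathbb{Q}$. For integers $n,s$ with $s\ge 0$, $a(n,s)$ denotes the number of lattice paths inside the rectangle $(n+2-2s)\times(n+2)$ (width $n+2-2s$, height $n+2$, boundary included) from the bottom left corner $(0,0)$ to the top right corner $(n+2-2s,n+2)$ with moves of two types: $(x,y)\to(x+1,y+1)$ or $(x,y)\to(x-1,y+1)$. If $n+2-2s<0$ then $a(n,s)=0$. *)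

(* Defs.v *)
From HB Require Import structures.
From mathcomp Require Import all_boot all_order all_algebra all_field.
From mathcomp Require Import complex reals.
From mathcomp Require Import mpoly.

Set Implicit Arguments.
Unset Strict Implicit.
Unset Printing Implicit Defensive.

Import GRing.Theory.
Local Open Scope ring_scope.

(* The exterior algebra over K on x_0, ..., x_(n-1) has the K-basis of         *)
(* monomials x_A = x_(a_1) * ... * x_(a_s), one for each subset                *)
(* A = {a_1 < ... < a_s} of 'I_n. The element f stands for                     *)
(* \sum_A f A *: x_A. The alias hides the pointwise product of {ffun _ -> _}.  *)
Definition exterior (K : fieldType) (n : nat) : Type := {ffun {set 'I_n} -> K^o}.

HB.instance Definition _ (K : fieldType) (n : nat) :=
  Vector.copy (exterior K n) {ffun {set 'I_n} -> K^o}.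

Section Exterior.
Variables (K : fieldType) (n : nat).
Implicit Types (A B C : {set 'I_n}) (f g h : exterior K n).

Definition ext_coef f A : K := f A.

Definition ext_monom A : exterior K n := [ffun B => (B == A)%:R].

Definition ext_gen (i : 'I_n) : exterior K n := ext_monom [set i].

(* Moving the factors of x_B to their places in x_A * x_B costs one sign per   *)
(* pair (a, b) in A x B with b < a.                                            *)
Definition inversions A B : {set 'I_n * 'I_n} :=
  [set p | [&& p.1 \in A, p.2 \in B & (p.2 < p.1)%N]].

Definition ext_sign A B : K :=
  if [disjoint A & B] then (-1) ^+ #|inversions A B| else 0.

Definition ext_mul f g : exterior K n :=
  \sum_A \sum_B (ext_coef f A * ext_coef g B * ext_sign A B) *: ext_monom (A :|: B).

Definition ext_one : exterior K n := ext_monom set0.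

Lemma ext_coefD f g A : ext_coef (f + g) A = ext_coef f A + ext_coef g A.
Proof. exact: ffunE. Qed.

Lemma ext_coefZ a f A : ext_coef (a *: f) A = a * ext_coef f A.
Proof. exact: ffunE. Qed.

Lemma ext_coef_monom A B : ext_coef (ext_monom A) B = (B == A)%:R.
Proof. exact: ffunE. Qed.

Lemma ext_sumE f : f = \sum_A ext_coef f A *: ext_monom A.
Proof.
apply/ffunP => B; rewrite sum_ffunE (bigD1 B) //= big1 => [|A nAB].
  by rewrite addr0 [RHS]ext_coefZ ext_coef_monom eqxx mulr1.
by rewrite [LHS]ext_coefZ ext_coef_monom eq_sym (negPf nAB) mulr0.
Qed.

Lemma ext_mulDl : left_distributive ext_mul +%R.
Proof.
move=> f g h; rewrite /ext_mul -big_split; apply: eq_bigr => A _ /=.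
rewrite -big_split; apply: eq_bigr => B _ /=.
by rewrite ext_coefD !mulrDl scalerDl.
Qed.

Lemma ext_mulDr : right_distributive ext_mul +%R.
Proof.
move=> f g h; rewrite /ext_mul -big_split; apply: eq_bigr => A _ /=.
rewrite -big_split; apply: eq_bigr => B _ /=.
by rewrite ext_coefD mulrDr mulrDl scalerDl.
Qed.

Lemma ext_mulZl a f g : a *: ext_mul f g = ext_mul (a *: f) g.
Proof.
rewrite scaler_sumr; apply: eq_bigr => A _; rewrite scaler_sumr.
by apply: eq_bigr => B _; rewrite scalerA ext_coefZ -!mulrA.
Qed.

Lemma ext_mulZr a f g : a *: ext_mul f g = ext_mul f (a *: g).
Proof.
rewrite scaler_sumr; apply: eq_bigr => A _; rewrite scaler_sumr.
by apply: eq_bigr => B _; rewrite scalerA ext_coefZ !mulrA [a * _]mulrC.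
Qed.

Lemma ext_mul0 f : ext_mul 0 f = 0.
Proof. by rewrite -(scale0r 0) -ext_mulZl !scale0r. Qed.

Lemma ext_mulr0 f : ext_mul f 0 = 0.
Proof. by rewrite -(scale0r 0) -ext_mulZr !scale0r. Qed.

Lemma ext_mul_suml (I : finType) (F : I -> exterior K n) g :
  ext_mul (\sum_i F i) g = \sum_i ext_mul (F i) g.
Proof.
by apply: (big_morph (ext_mul^~ g)) => [f h|]; rewrite ?ext_mulDl ?ext_mul0.
Qed.

Lemma ext_mul_sumr (I : finType) (F : I -> exterior K n) g :
  ext_mul g (\sum_i F i) = \sum_i ext_mul g (F i).
Proof.
by apply: (big_morph (ext_mul g)) => [f h|]; rewrite ?ext_mulDr ?ext_mulr0.
Qed.

Lemma ext_monomM A B :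
  ext_mul (ext_monom A) (ext_monom B) = ext_sign A B *: ext_monom (A :|: B).
Proof.
rewrite /ext_mul (bigD1 A) //= [X in _ + X]big1 => [|A' nA]; last first.
  by rewrite big1 // => B' _; rewrite !ext_coef_monom (negPf nA) !mul0r scale0r.
rewrite (bigD1 B) //= big1 => [|B' nB].
  by rewrite !ext_coef_monom !eqxx !mul1r !addr0.
by rewrite !ext_coef_monom (negPf nB) mulr0 mul0r scale0r.
Qed.

Lemma card_inversionsUl A B C : [disjoint A & B] ->
  #|inversions (A :|: B) C| = (#|inversions A C| + #|inversions B C|)%N.
Proof.
move=> dAB; rewrite -cardsUI [X in (_ + X)%N]eq_card0 ?addn0 => [|[i j]].
  by apply: eq_card => -[i j]; rewrite !inE -andb_orl.
rewrite !inE /=; have [iA|] //= := boolP (i \in A).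
by rewrite (disjointFr dAB iA) andbF.
Qed.

Lemma card_inversionsUr A B C : [disjoint B & C] ->
  #|inversions A (B :|: C)| = (#|inversions A B| + #|inversions A C|)%N.
Proof.
move=> dBC; rewrite -cardsUI [X in (_ + X)%N]eq_card0 ?addn0 => [|[i j]].
  by apply: eq_card => -[i j]; rewrite !inE /= -andb_orr -andb_orl.
rewrite !inE /=; have [jB|] := boolP (j \in B); last by rewrite andbF.
by rewrite (disjointFr dBC jB) !andbF.
Qed.

Lemma ext_signA A B C :
  ext_sign B C * ext_sign A (B :|: C) = ext_sign A B * ext_sign (A :|: B) C.
Proof.
rewrite /ext_sign -!setI_eq0 setIUr setIUl !setU_eq0 !setI_eq0.
case: (boolP [disjoint B & C]) => dBC; rewrite ?andbF ?mulr0 ?mul0r //=.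
case: (boolP [disjoint A & B]) => dAB /=; rewrite ?mulr0 ?mul0r //=.
case: (boolP [disjoint A & C]) => dAC /=; rewrite ?mulr0 ?mul0r //.
by rewrite card_inversionsUl // card_inversionsUr // -!exprD addnC -addnA.
Qed.

Lemma ext_mulA : associative ext_mul.
Proof.
have [m Em] : {m | m = ext_mul} by exists ext_mul.
have := (ext_mul_suml, ext_mul_sumr, ext_mulZl, ext_mulZr, ext_monomM).
rewrite -Em => -[[[[suml sumr] scal] scar] monomM] f g h.
rewrite (ext_sumE f) !suml; apply: eq_bigr => A _.
rewrite (ext_sumE g) suml !sumr suml; apply: eq_bigr => B _.
rewrite (ext_sumE h) !sumr; apply: eq_bigr => C _.
rewrite -!(scal, scar) !monomM -!(scal, scar) !monomM !scalerA setUA.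
by congr (_ *: _); rewrite -!mulrA ext_signA [RHS]mulrCA; congr (_ * _);
  rewrite [RHS]mulrCA; congr (_ * _).
Qed.

Lemma ext_mul1f : left_id ext_one ext_mul.
Proof.
move=> f; rewrite {2}(ext_sumE f) {1}(ext_sumE f) ext_mul_sumr.
apply: eq_bigr => A _; rewrite -ext_mulZr ext_monomM set0U /ext_sign.
rewrite disjoint_sym -setI_eq0 setI0 eqxx [#|_|]eq_card0 ?scale1r // => p.
by rewrite !inE.
Qed.

Lemma ext_mulf1 : right_id ext_one ext_mul.
Proof.
move=> f; rewrite {2}(ext_sumE f) {1}(ext_sumE f) ext_mul_suml.
apply: eq_bigr => A _; rewrite -ext_mulZl ext_monomM setU0 /ext_sign.
rewrite -setI_eq0 setI0 eqxx [#|_|]eq_card0 ?scale1r // => p.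
by rewrite !inE andbF.
Qed.

Lemma ext_one_neq0 : ext_one != 0.
Proof.
by apply/eqP => /ffunP/(_ set0)/eqP; rewrite !ffunE eqxx oner_eq0.
Qed.

End Exterior.

HB.instance Definition _ (K : fieldType) (n : nat) :=
  GRing.Zmodule_isNzRing.Build (exterior K n)
    (@ext_mulA K n) (@ext_mul1f K n) (@ext_mulf1 K n)
    (@ext_mulDl K n) (@ext_mulDr K n) (@ext_one_neq0 K n).
HB.instance Definition _ (K : fieldType) (n : nat) :=
  GRing.Lmodule_isLalgebra.Build K (exterior K n) (@ext_mulZl K n).
HB.instance Definition _ (K : fieldType) (n : nat) :=
  GRing.Lalgebra_isAlgebra.Build K (exterior K n) (@ext_mulZr K n).
HB.instance Definition _ (K : fieldType) (n : nat) :=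
  Algebra_isFalgebra.Build K (exterior K n).

Section Presentation.
Variables (K : fieldType) (n : nat).

Lemma ext_gen_sq (i : 'I_n) : ext_gen K i * ext_gen K i = 0.
Proof.
rewrite [LHS]ext_monomM /ext_sign -setI_eq0 setIid -cards_eq0 cards1.
exact: scale0r.
Qed.

Lemma ext_gen_anticomm (i j : 'I_n) :
  ext_gen K i * ext_gen K j = - (ext_gen K j * ext_gen K i).
Proof.
wlog ltij : i j / (i < j)%N => [th|].
  case: (ltngtP i j) => [/th// | /th -> | /val_inj ->]; first by rewrite opprK.
  by rewrite ext_gen_sq oppr0.
have nij : [disjoint [set i] & [set j]].
  by rewrite disjoints1 !inE neq_ltn ltij.
rewrite [X in X = _]ext_monomM [X in - X]ext_monomM setUC -scaleNr.
congr (_ *: _); rewrite /ext_sign [[disjoint [set j] & _]]disjoint_sym nij.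
rewrite [X in _ ^+ X]eq_card0 => [|p]; last first.
  rewrite !inE; apply/and3P => -[/eqP-> /eqP->].
  by rewrite ltnNge ltnW.
rewrite [X in - (_ ^+ X)](@eq_card1 _ (j, i)) ?expr1 ?opprK // => -[a b].
rewrite !inE xpair_eqE /=.
by apply/and3P/andP => [[-> -> //]|[/eqP-> /eqP->]]; rewrite !eqxx.
Qed.

Lemma ext_monomE (A : {set 'I_n}) :
  ext_monom K A = \prod_(i <- enum A) ext_gen K i.
Proof.
have: sorted (relpre (@nat_of_ord n) ltn) (enum A).
  rewrite /enum_mem; apply: sorted_filter; first by move=> ? ? ?; apply: ltn_trans.
  by rewrite -enumT -sorted_map val_enum_ord iota_ltn_sorted.
rewrite -[in LHS](set_enum A); elim: (enum A) => [_|i s IHs /= lt_s].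
  by rewrite big_nil set_nil.
rewrite big_cons -IHs ?(path_sorted lt_s) // [RHS]ext_monomM set_cons /ext_sign.
have lt_is j : j \in s -> (i < j)%N.
  by move/(order_path_min (fun _ _ _ => @ltn_trans _ _ _)): lt_s => /allP; apply.
rewrite disjoints1 inE; case: ifP => [|/negbFE/lt_is]; last by rewrite ltnn.
move=> _; rewrite [X in _ ^+ X]eq_card0 ?scale1r // => -[a b].
rewrite !inE /=; apply/and3P => -[/eqP-> /lt_is lt_ib].
by rewrite ltnNge ltnW.
Qed.

End Presentation.

Section QuotientAlgebra.
Variables (K : fieldType) (aT : falgType K).

(* The span of all products u * x * v with x in X is the two-sided ideal (X). *)
Definition ideal_gen (X : seq aT) : {vspace aT} :=
  ({:aT} * <<X>> * {:aT})%VS.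

Variable X : seq aT.
Local Notation I := (ideal_gen X).

Lemma ideal_gen_sub : {subset X <= I}.
Proof.
move=> x Xx; rewrite -[x]mulr1 -[x]mul1r.
by rewrite !memv_mul ?memvf ?memv_span.
Qed.

Lemma ideal_genMl u v : v \in I -> u * v \in I.
Proof.
move=> Iv; have: ({:aT} * I <= I)%VS.
  by rewrite /ideal_gen !prodvA; do 2 apply: prodvSl; exact: subvf.
by move/prodvP; apply; rewrite ?memvf.
Qed.

Lemma ideal_genMr u v : u \in I -> u * v \in I.
Proof.
move=> Iu; have: (I * {:aT} <= I)%VS.
  by rewrite /ideal_gen -!prodvA; do 2 apply: prodvSr; exact: subvf.
by move/prodvP; apply; rewrite ?memvf.
Qed.

Lemma ideal_gen_min (J : {vspace aT}) :
    {subset X <= J} -> (forall u v, v \in J -> u * v \in J) ->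
    (forall u v, u \in J -> u * v \in J) ->
  (I <= J)%VS.
Proof.
move=> sXJ Jl Jr; apply/prodvP => u v Iu _; apply: Jr.
suff /subvP: ({:aT} * <<X>> <= J)%VS by apply.
apply/prodvP => {Iu v}u v _ Xv; apply: Jl.
by have /span_subvP/subvP := sXJ; apply.
Qed.

Definition quotalg : Type := Quotient.quot (pred_of_vspace I).

HB.instance Definition _ := GRing.Zmodule.on quotalg.
HB.instance Definition _ := EqQuotient.on quotalg.

Definition quot_proj : aT -> quotalg := \pi_quotalg%qT.
Definition quot_lift : quotalg -> aT := repr.
Local Notation pr := quot_proj.
Local Notation rp := quot_lift.

Lemma quot_projK : cancel rp pr.
Proof. exact: reprK. Qed.

Lemma quot_projP u v : reflect (quot_proj u = quot_proj v) (u - v \in I).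
Proof.
by rewrite (Quotient.idealrBE (pred_of_vspace I)); apply: eqP.
Qed.

Lemma quot_projB : {morph quot_proj : u v / u - v}.
Proof. exact: (raddfB (\pi_(Quotient.quot (pred_of_vspace I)))%qT). Qed.

Lemma quot_projD : {morph quot_proj : u v / u + v}.
Proof. exact: (raddfD (\pi_(Quotient.quot (pred_of_vspace I)))%qT). Qed.

Lemma quot_liftK u : rp (pr u) - u \in I.
Proof. by apply/quot_projP; rewrite quot_projK. Qed.

Definition quot_one : quotalg := pr 1.
Definition quot_mul (x y : quotalg) : quotalg := pr (rp x * rp y).
Definition quot_scale (a : K) (x : quotalg) : quotalg := pr (a *: rp x).

Lemma quot_projM u v : pr (u * v) = quot_mul (pr u) (pr v).
Proof.
apply/esym/quot_projP; set u' := rp _; set v' := rp _.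
rewrite -[u' * v'](subrK (u' * v)) -mulrBr -addrA -mulrBl.
by apply: rpredD; [apply: ideal_genMl | apply: ideal_genMr]; apply: quot_liftK.
Qed.

Lemma quot_projZ a u : pr (a *: u) = quot_scale a (pr u).
Proof. by apply/esym/quot_projP; rewrite -scalerBr memvZ ?quot_liftK. Qed.

Lemma quot_mulA : associative quot_mul.
Proof.
move=> x y z; rewrite -[x]quot_projK -[y]quot_projK -[z]quot_projK.
by rewrite -!quot_projM mulrA.
Qed.

Lemma quot_mul1x : left_id quot_one quot_mul.
Proof. by move=> x; rewrite -[x]quot_projK -quot_projM mul1r. Qed.

Lemma quot_mulx1 : right_id quot_one quot_mul.
Proof. by move=> x; rewrite -[x]quot_projK -quot_projM mulr1. Qed.

Lemma quot_mulDl : left_distributive quot_mul +%R.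
Proof.
move=> x y z; rewrite -[x]quot_projK -[y]quot_projK -[z]quot_projK.
by rewrite -quot_projD -!quot_projM mulrDl quot_projD.
Qed.

Lemma quot_mulDr : right_distributive quot_mul +%R.
Proof.
move=> x y z; rewrite -[x]quot_projK -[y]quot_projK -[z]quot_projK.
by rewrite -quot_projD -!quot_projM mulrDr quot_projD.
Qed.

(* Not an nzRingType: (X) may be the whole algebra.                            *)
HB.instance Definition _ := GRing.Zmodule_isPzRing.Build quotalg
  quot_mulA quot_mul1x quot_mulx1 quot_mulDl quot_mulDr.

Lemma quot_scaleA a b x : quot_scale a (quot_scale b x) = quot_scale (a * b) x.
Proof. by rewrite -[x]quot_projK -!quot_projZ scalerA. Qed.

Lemma quot_scale1 : left_id 1 quot_scale.
Proof. by move=> x; rewrite -[x]quot_projK -quot_projZ scale1r. Qed.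

Lemma quot_scaleDr : right_distributive quot_scale +%R.
Proof.
move=> a x y; rewrite -[x]quot_projK -[y]quot_projK.
by rewrite -quot_projD -!quot_projZ scalerDr quot_projD.
Qed.

Lemma quot_scaleDl x : {morph quot_scale^~ x : a b / a + b}.
Proof.
by move=> a b; rewrite -[x]quot_projK -!quot_projZ scalerDl quot_projD.
Qed.

HB.instance Definition _ := GRing.Zmodule_isLmodule.Build K quotalg
  quot_scaleA quot_scale1 quot_scaleDr quot_scaleDl.

Lemma quot_proj_is_linear : linear quot_proj.
Proof. by move=> a u v; rewrite quot_projD quot_projZ. Qed.
HB.instance Definition _ :=
  GRing.isLinear.Build K aT quotalg _ quot_proj quot_proj_is_linear.

Lemma quot_proj_is_monoid_morphism : monoid_morphism quot_proj.
Proof. by split=> // u v; apply: quot_projM. Qed.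
HB.instance Definition _ :=
  GRing.isMonoidMorphism.Build aT quotalg quot_proj quot_proj_is_monoid_morphism.

Lemma quot_scaleAl a (x y : quotalg) : a *: (x * y) = a *: x * y.
Proof.
rewrite -[x]quot_projK -[y]quot_projK -rmorphM -!linearZ -rmorphM /=.
by rewrite scalerAl.
Qed.

Lemma quot_scaleAr a (x y : quotalg) : a *: (x * y) = x * (a *: y).
Proof.
rewrite -[x]quot_projK -[y]quot_projK -rmorphM -!linearZ -rmorphM /=.
by rewrite scalerAr.
Qed.

(* The coordinates of a class are those of the component in I^C of any of its  *)
(* representatives.                                                            *)
Lemma quot_vect_axiom : Vector.axiom (\dim I^C) quotalg.
Proof.
have dIC : (I^C :&: I = 0)%VS by rewrite capvC capv_compl.
pose c := daddv_pi I^C I.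
have cB u : u - c u \in I.
  have IC_I : u \in (I^C + I)%VS by rewrite addvC addv_complf memvf.
  by rewrite -[u in u - _](daddv_pi_add dIC IC_I) addrC addKr memv_pi.
have cI u v : u - v \in I -> c u = c v.
  move=> Iuv; apply/eqP; rewrite -subr_eq0 -memv0 -dIC memv_cap.
  rewrite rpredB ?memv_pi //=.
  have E : (u - c u) - (v - c v) = (u - v) - (c u - c v).
    by rewrite !opprD !opprK addrACA.
  rewrite -[c u - c v](subKr (u - v)) -E.
  by apply: (rpredB Iuv); apply: rpredB; apply: cB.
have cP u : c (rp (pr u)) = c u by apply/cI/quot_liftK.
exists (fun x => \row_i coord (vbasis I^C) i (c (rp x))).
  move=> k x y; apply/rowP => i; rewrite !mxE -linearP -linearP; congr (coord _ _ _).
  by rewrite -[x in LHS]quot_projK -[y in LHS]quot_projK -linearP cP.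
exists (fun r : 'rV_(\dim I^C) => pr (\sum_i r 0 i *: (vbasis I^C)`_i)) => [x|r].
  rewrite -[RHS]quot_projK; apply/esym/quot_projP.
  rewrite (eq_bigr (fun i => coord (vbasis I^C) i (c (rp x)) *: (vbasis I^C)`_i)).
    by rewrite -(coord_vbasis (memv_pi _ _ _)).
  by move=> i _; rewrite mxE.
apply/rowP => i; rewrite mxE cP /c daddv_pi_id //.
  by rewrite coord_sum_free ?(basis_free (vbasisP _)).
by apply: rpred_sum => j _; rewrite rpredZ ?vbasis_mem ?memt_nth.
Qed.

HB.instance Definition _ := Lmodule_hasFinDim.Build K quotalg quot_vect_axiom.

End QuotientAlgebra.

Section GradedComponents.
Variables (K : fieldType) (n : nat).

Definition ext_homog (s : nat) : {vspace exterior K n} :=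
  <<[seq ext_monom K A | A : {set 'I_n} in [set B : {set 'I_n} | #|B| == s]]>>%VS.

(* The image of the s-th component of E. It is the s-th component of E / (X)   *)
(* when the elements of X are homogeneous.                                     *)
Definition quot_homog (X : seq (exterior K n)) (s : nat) : {vspace quotalg X} :=
  (linfun (@quot_proj K (exterior K n) X) @: ext_homog s)%VS.

End GradedComponents.

(* Algebraic independence over the rationals of the family c.                  *)
Definition alg_independent (L : fieldType) (T : finType) (c : T -> L) : Prop :=
  forall p : {mpoly rat[#|T|]},
    (map_mpoly ratr p).@[fun i => c (enum_val i)] = 0 -> p = 0.

Section Generic.
Variables (K : fieldType) (n : nat).

(* The coefficients of x_i * x_j, i < j, in f (at true) and in g (at false).   *)
Definition quadratic_coefs (f g : exterior K n)
    (t : bool * {A : {set 'I_n} | #|A| == 2%N}) : K :=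
  ext_coef (if t.1 then f else g) (val t.2).

Definition generic_quadratic_pair (f g : exterior K n) : Prop :=
  [/\ f \in ext_homog K n 2, g \in ext_homog K n 2 &
      alg_independent (quadratic_coefs f g)].

End Generic.

Section LatticePaths.
Local Open Scope int_scope.

Definition lattice_move (p : int * int) (right : bool) : int * int :=
  (if right then p.1 + 1 else p.1 - 1, p.2 + 1).

Definition in_rectangle (w h : int) (p : int * int) : bool :=
  [&& 0 <= p.1, p.1 <= w, 0 <= p.2 & p.2 <= h].

Definition is_lattice_path (w h : int) (m : seq bool) : bool :=
  all (in_rectangle w h) ((0, 0) :: scanl lattice_move (0, 0) m) &&
  (foldl lattice_move (0, 0) m == (w, h)).

(* Every move raises the second coordinate by one, so the paths to height      *)
(* n + 2 are given by sequences of n + 2 moves. If n + 2 - 2 * s < 0 the       *)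
(* rectangle is empty and there is no path.                                    *)
Definition num_lattice_paths (n s : nat) : nat :=
  #|[set m : (n + 2).-tuple bool |
      is_lattice_path (n%:Z + 2 - 2 * s%:Z) (n%:Z + 2) m]|.

End LatticePaths.

(* Main.v *)
From HB Require Import structures.
Require Import Defs.
From mathcomp Require Import all_boot all_order all_algebra all_field.
From mathcomp Require Import complex reals.
From mathcomp Require Import mpoly zify.

Set Implicit Arguments.
Unset Strict Implicit.
Unset Printing Implicit Defensive.

Import Order.TTheory GRing.Theory Num.Theory.
Local Open Scope ring_scope.

(** The multiplication E_s x E_(n-s) -> E_n is a perfect pairing, and the
    orthogonal of (f, g)_s consists of the elements u of degree n - s with
    f u = g u = 0. So the dimension of (E / (f, g))_s is that of this annihilator
    (dim_quot_homog), and the theorem says that in degree d <= k the annihilator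
    is zero for d < k, and for d = k has dimension 2^k if n = 2k and dimension 1
    if n = 2k + 1.

    Upper bounds. The annihilator is the kernel of a matrix whose entries are
    linear in the coefficients of f and g, and the rank of this matrix is maximal at a
    generic pair. It therefore suffices to bound the annihilator of one pair with
    rational coefficients (generic_dim_annih_le). For n = 2k take sums of
    x_i z_i with two sets of coefficients whose ratios are distinct: an element
    of degree at most k that both forms kill only involves monomials with one
    variable from each pair {x_i, z_i} (pair_pencil_annih). For n = 2k + 1 take
    the sum of the x_i z_i and that of the x_i z_(i-1), 1 <= i <= k: only the
    multiples of x_1 ... x_k survive (odd_pencil_annih). Both arguments remove
    one pair of variables at a time and rest on the fact that a sum of m
    products of disjoint pairs multiplies injectively in degrees below m
    (pair_form_inj).

    Lower bounds. If y_1, ..., y_n is a basis of the linear forms and T is such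
    that every term of f and of g in this basis contains some y_i with i in T,
    then f and g kill the product y_T of the y_i, i in T; distinct sets T give
    independent products (annih_ge). So one needs bases adapted to a pair of
    skew-symmetric matrices. In odd dimension 2k + 1 any such pair has a common
    isotropic subspace of dimension k + 1 (skew_odd_isotropic), which gives one
    set T of size k. In even dimension 2k, if the pencil has k distinct
    eigenvalues, each eigenspace has dimension at least 2 and both matrices
    become block diagonal with blocks of size 2 (skew_even_normal); every
    choice of one index in each block is then a set T. Having k distinct
    eigenvalues follows from the non-vanishing of a determinant of traces
    (hankel_distinct_eigenvalues), a polynomial in the coefficients that is
    nonzero at one rational pair, hence at a generic one.

    On the combinatorial side the rectangles are strips of width 1, 2, 0 or
    negative, where the paths are counted directly. *)

(** * Supports and splitting off a variable *)

Section Support.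
Variables (K : fieldType) (n : nat).
Local Notation E := (exterior K n).
Local Notation x := (ext_gen K).
Implicit Types (u v : E) (A B C : {set 'I_n}) (P Q S : {set 'I_n} -> bool).

Definition ext_supp P u := forall A, ext_coef u A != 0 -> P A.

Lemma ext_coefP u v : (forall A, ext_coef u A = ext_coef v A) -> u = v.
Proof. by move=> e; apply/ffunP=> A; apply: e. Qed.

Lemma ext_coef0 A : ext_coef (0 : E) A = 0.
Proof. exact: ffunE. Qed.

Lemma ext_coef_sum (I : Type) (r : seq I) (p : pred I) (F : I -> E) A :
  ext_coef (\sum_(i <- r | p i) F i) A = \sum_(i <- r | p i) ext_coef (F i) A.
Proof.
apply: (big_morph ((@ext_coef K n)^~ A)) => [u v|]; [exact: ext_coefD | exact: ext_coef0].
Qed.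

Lemma ext_supp_coef0 P u A : ext_supp P u -> ~~ P A -> ext_coef u A = 0.
Proof. by move=> sP nPA; apply/eqP/negP => /negP /sP; apply/negP. Qed.

Lemma ext_suppW P Q u : (forall A, P A -> Q A) -> ext_supp P u -> ext_supp Q u.
Proof. by move=> PQ sP A /sP /PQ. Qed.

Lemma ext_supp0 P : ext_supp P 0.
Proof. by move=> A; rewrite ext_coef0 eqxx. Qed.

Lemma ext_supp_pred0 P u : (forall A, ~~ P A) -> ext_supp P u -> u = 0.
Proof.
by move=> P0 sP; apply: ext_coefP => A; rewrite ext_coef0 (ext_supp_coef0 sP).
Qed.

Lemma ext_suppD P u v : ext_supp P u -> ext_supp P v -> ext_supp P (u + v).
Proof.
move=> su sv A; rewrite ext_coefD.
case: (eqVneq (ext_coef u A) 0) => [->|/su //].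
by rewrite add0r => /sv.
Qed.

Lemma ext_suppZ P a u : ext_supp P u -> ext_supp P (a *: u).
Proof. by move=> su A; rewrite ext_coefZ mulf_eq0 negb_or => /andP[_ /su]. Qed.

Lemma ext_supp_sum P (I : eqType) (r : seq I) (F : I -> E) :
  (forall i, i \in r -> ext_supp P (F i)) -> ext_supp P (\sum_(i <- r) F i).
Proof.
move=> sF; rewrite big_seq; apply: (big_ind (ext_supp P)) => //.
  exact: ext_supp0.
by move=> u v; apply: ext_suppD.
Qed.

Lemma ext_supp_monom P A : P A -> ext_supp P (ext_monom K A).
Proof. by move=> PA B; rewrite ext_coef_monom; case: (eqVneq B A) => [-> //|_]; rewrite eqxx. Qed.

Lemma ext_mulE u v : u * v =
  \sum_A \sum_B (ext_coef u A * ext_coef v B * ext_sign K A B) *: ext_monom K (A :|: B).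
Proof. by []. Qed.

Lemma ext_suppM P Q S u v :
    (forall A B, P A -> Q B -> [disjoint A & B] -> S (A :|: B)) ->
  ext_supp P u -> ext_supp Q v -> ext_supp S (u * v).
Proof.
move=> PQ su sv; rewrite ext_mulE.
apply: ext_supp_sum => A _; apply: ext_supp_sum => B _.
have [uA|/su PA] := eqVneq (ext_coef u A) 0.
  by rewrite uA !mul0r scale0r; apply: ext_supp0.
have [vB|/sv QB] := eqVneq (ext_coef v B) 0.
  by rewrite vB mulr0 mul0r scale0r; apply: ext_supp0.
rewrite /ext_sign; case: ifP => [dAB|_].
  by apply/ext_suppZ/ext_supp_monom/PQ.
by rewrite mulr0 scale0r; apply: ext_supp0.
Qed.

Lemma ext_gen_monom i A : x i * ext_monom K A =
  if i \in A then 0 else ext_sign K [set i] A *: ext_monom K (i |: A).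
Proof.
rewrite [LHS](ext_monomM K); case: ifP => // iA.
by rewrite /ext_sign disjoints1 iA scale0r.
Qed.

Lemma ext_coef_gen_mul i u A : ext_coef (x i * u) A =
  if i \in A then ext_sign K [set i] (A :\ i) * ext_coef u (A :\ i) else 0.
Proof.
rewrite {1}(ext_sumE u) mulr_sumr ext_coef_sum.
transitivity (\sum_B (if (i \in A) && (B == A :\ i)
    then ext_sign K [set i] B * ext_coef u B else 0)).
  apply: eq_bigr => B _; rewrite -scalerAr ext_coefZ ext_gen_monom.
  case: ifP => iB.
    rewrite ext_coef0 mulr0; case: ifP => // /andP[_ /eqP eB].
    by rewrite eB !inE eqxx in iB.
  rewrite ext_coefZ ext_coef_monom.
  case: (eqVneq A (i |: B)) => [->|nA].
    by rewrite setU11 setU1K ?iB // eqxx mulr1 mulrC.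
  rewrite !mulr0; case: ifP => // /andP[iA /eqP eB].
  by rewrite eB setD1K // eqxx in nA.
case: ifP => iA /=; last by rewrite big1.
by rewrite -big_mkcond big_pred1_eq.
Qed.

Lemma ext_sign_sq A B : [disjoint A & B] -> ext_sign K A B * ext_sign K A B = 1.
Proof. by rewrite /ext_sign => ->; rewrite -expr2 sqrr_sign. Qed.

Lemma ext_sign_neq0 A B : [disjoint A & B] -> ext_sign K A B != 0.
Proof. by rewrite /ext_sign => ->; rewrite signr_eq0. Qed.

Lemma disjoint1D1 i A : [disjoint [set i] & A :\ i].
Proof. by rewrite disjoints1 !inE eqxx. Qed.

Lemma ext_split P u i : ext_supp P u -> exists a b,
  [/\ u = a + x i * b, ext_supp (fun A => P A && (i \notin A)) a &
      ext_supp (fun A => P (i |: A) && (i \notin A)) b].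
Proof.
move=> su.
pose a : E := [ffun A : {set 'I_n} => if i \in A then 0 else ext_coef u A : K^o].
pose b : E := [ffun A : {set 'I_n} => if i \in A then 0 else
   ext_sign K [set i] A * ext_coef u (i |: A) : K^o].
have aE A : ext_coef a A = if i \in A then 0 else ext_coef u A by exact: ffunE.
have bE A : ext_coef b A = if i \in A then 0 else
  ext_sign K [set i] A * ext_coef u (i |: A) by exact: ffunE.
exists a, b; split=> [|A|A].
- apply: ext_coefP => A; rewrite ext_coefD ext_coef_gen_mul aE bE !inE eqxx /=.
  case: ifP => iA; last by rewrite addr0.
  by rewrite mulrA ext_sign_sq ?disjoint1D1 // mul1r add0r setD1K.
- by rewrite aE; case: ifP => [|iA /su ->//]; rewrite eqxx.
- rewrite bE; case: ifP => [|iA]; first by rewrite eqxx.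
  by rewrite mulf_eq0 negb_or => /andP[_ /su ->].
Qed.

Definition ext_free i u := ext_supp (fun A => i \notin A) u.

Lemma ext_split_eq0 i a b : ext_free i a -> ext_free i b ->
  a + x i * b = 0 -> a = 0 /\ b = 0.
Proof.
move=> fa fb ab0.
have c A : ext_coef a A + ext_coef (x i * b) A = 0 by rewrite -ext_coefD ab0 ext_coef0.
split; apply: ext_coefP => A; rewrite ext_coef0; have [iA|iA] := boolP (i \in A).
- by rewrite (ext_supp_coef0 fa) // negbK.
- by have := c A; rewrite ext_coef_gen_mul (negbTE iA) addr0.
- by rewrite (ext_supp_coef0 fb) // negbK.
have := c (i |: A).
rewrite (ext_supp_coef0 fa) ?negbK ?setU11 // add0r ext_coef_gen_mul setU11 setU1K //.
by move/eqP; rewrite mulf_eq0 (negbTE (ext_sign_neq0 _)) ?disjoints1 //= => /eqP.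
Qed.

Lemma ext_freeM i u v : ext_free i u -> ext_free i v -> ext_free i (u * v).
Proof. by apply: ext_suppM => A B iA iB _; rewrite inE negb_or iA. Qed.

Lemma ext_freeD i u v : ext_free i u -> ext_free i v -> ext_free i (u + v).
Proof. exact: ext_suppD. Qed.

Lemma ext_free_gen i j : i != j -> ext_free i (x j).
Proof. by move=> nij; apply: ext_supp_monom; rewrite inE. Qed.

Lemma ext_freeX i u m : ext_free i u -> ext_free i (u ^+ m).
Proof.
move=> fu; elim: m => [|m IH]; last by rewrite exprS; apply: ext_freeM.
by apply: ext_supp_monom; rewrite inE.
Qed.

(** A generator changes sign when it passes another one, so a product of two of
    them passes everything. *)
Lemma ext_quad_comm i j u : GRing.comm u (x i * x j).
Proof.
have cg l : x l * (x i * x j) = x i * x j * x l.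
  rewrite mulrA (ext_gen_anticomm K l i) mulNr -[in LHS]mulrA.
  by rewrite (ext_gen_anticomm K l j) mulrN opprK mulrA.
rewrite /GRing.comm {1}(ext_sumE u) {2}(ext_sumE u) mulr_suml mulr_sumr.
apply: eq_bigr => A _; rewrite -scalerAl -scalerAr; congr (_ *: _).
rewrite (ext_monomE K); elim: (enum A) => [|l s IH].
  by rewrite big_nil mul1r mulr1.
by rewrite big_cons -mulrA IH mulrA cg mulrA.
Qed.

Lemma ext_gen_sq' i u : x i * (x i * u) = 0.
Proof. by rewrite mulrA ext_gen_sq mul0r. Qed.

Lemma ext_gen_anticomm' i j u : x i * (x j * u) = - (x j * (x i * u)).
Proof. by rewrite mulrA ext_gen_anticomm mulNr -mulrA. Qed.

Lemma ext_split2 P u i j : i != j -> ext_supp P u -> exists a b c d,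
  [/\ u = a + x i * b + x j * c + x i * x j * d,
      ext_supp (fun A => [&& P A, i \notin A & j \notin A]) a,
      ext_supp (fun A => [&& P (i |: A), i \notin A & j \notin A]) b,
      ext_supp (fun A => [&& P (j |: A), i \notin A & j \notin A]) c &
      ext_supp (fun A => [&& P (i |: (j |: A)), i \notin A & j \notin A]) d].
Proof.
move=> nij su; have [a0 [b0 [-> sa0 sb0]]] := ext_split i su.
have [a [c [-> sa sc]]] := ext_split j sa0.
have [b [d [-> sb sd]]] := ext_split j sb0.
exists a, b, c, d; split.
- by rewrite mulrDr !mulrA -!addrA; congr (_ + _); rewrite !addrA [_ + x j * c]addrC.
- by apply: ext_suppW sa => A; rewrite -andbA.
- by apply: ext_suppW sb => A; rewrite -andbA.
- apply: ext_suppW sc => A; rewrite !inE negb_or -!andbA.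
  by case/and4P=> -> _ -> ->.
- apply: ext_suppW sd => A; rewrite !inE negb_or -!andbA.
  by case/and4P=> -> _ -> ->.
Qed.

Lemma ext_split2_eq0 i j a b c d : i != j ->
    (forall w, w \in [:: a; b; c; d] -> ext_free i w /\ ext_free j w) ->
    a + x i * b + x j * c + x i * x j * d = 0 ->
  [/\ a = 0, b = 0, c = 0 & d = 0].
Proof.
move=> nij fr e0.
have [[fia fja] [fib fjb]] : (ext_free i a /\ ext_free j a) /\ (ext_free i b /\ ext_free j b).
  by split; apply: fr; rewrite !inE eqxx ?orbT.
have [[fic fjc] [fid fjd]] : (ext_free i c /\ ext_free j c) /\ (ext_free i d /\ ext_free j d).
  by split; apply: fr; rewrite !inE eqxx ?orbT.
have e1 : (a + x j * c) + x i * (b + x j * d) = 0.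
  by rewrite -[RHS]e0 mulrDr mulrA !addrA; congr (_ + _); rewrite addrAC.
have [] := ext_split_eq0 _ _ e1.
- by apply: ext_freeD => //; apply: ext_freeM => //; apply: ext_free_gen.
- by apply: ext_freeD => //; apply: ext_freeM => //; apply: ext_free_gen.
by move=> /(ext_split_eq0 fja fjc)[-> ->] /(ext_split_eq0 fjb fjd)[-> ->].
Qed.

(** In the four components of u with respect to x_i and x_j, multiplication by
    h + x_i x_j e is multiplication by h, except that the coefficient of
    x_i x_j also receives e times the component free of both variables. *)
Lemma ext_pair_mul_eq0 i j h e a b c d : i != j ->
    (forall v, GRing.comm v h) ->
    (forall w, w \in [:: h; e; a; b; c; d] -> ext_free i w /\ ext_free j w) ->
    (h + x i * x j * e) * (a + x i * b + x j * c + x i * x j * d) = 0 ->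
  [/\ h * a = 0, h * b = 0, h * c = 0 & h * d + e * a = 0].
Proof.
move=> nij hC fr.
have [[fih fjh] [fie fje]] : (ext_free i h /\ ext_free j h) /\ (ext_free i e /\ ext_free j e).
  by split; apply: fr; rewrite !inE eqxx ?orbT.
have frM w : w \in [:: a; b; c; d] -> ext_free i (h * w) /\ ext_free j (h * w).
  move=> wi; have [|fi fj] := fr w; first by rewrite !inE in wi *; rewrite wi !orbT.
  by split; apply: ext_freeM.
have [fia fja] : ext_free i a /\ ext_free j a by apply: fr; rewrite !inE eqxx ?orbT.
have -> : (h + x i * x j * e) * (a + x i * b + x j * c + x i * x j * d)
  = h * a + x i * (h * b) + x j * (h * c) + x i * x j * (h * d + e * a).
  have qC := ext_quad_comm i j; set q := x i * x j in qC *.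
  have hM v w : h * (v * w) = v * (h * w) by rewrite mulrA -hC mulrA.
  have qi : q * x i = 0 by rewrite -qC ext_gen_sq'.
  have qj : q * x j = 0 by rewrite -mulrA ext_gen_sq mulr0.
  have q0 v w : q * v = 0 -> q * e * (v * w) = 0.
    by move=> qv; rewrite -qC -mulrA [q * _]mulrA qv mul0r mulr0.
  have qq : q * q = 0 by rewrite {2}/q mulrA qi mul0r.
  rewrite mulrDl !(mulrDr h) !hM !(mulrDr (q * e)) !q0 // !addr0 [q * (_ + _)]mulrDr.
  by rewrite -[q * e * a]mulrA !addrA.
have [|fiha fjha] := frM a; first by rewrite !inE eqxx.
have [|fihd fjhd] := frM d; first by rewrite !inE eqxx ?orbT.
move=> e0; have e0' := ext_split2_eq0 nij _ e0; apply: e0' => w; rewrite !inE.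
case/or4P=> /eqP ->; try by apply: frM; rewrite !inE eqxx ?orbT.
by split; apply: ext_freeD => //; apply: ext_freeM.
Qed.

End Support.

(** * Annihilators of two special pencils *)

Section SpecialPencils.
Variables (K : numFieldType) (n : nat).
Local Notation E := (exterior K n).
Local Notation x := (ext_gen K).
Implicit Types (u v : E) (A B : {set 'I_n}) (p : 'I_n * 'I_n) (ps : seq ('I_n * 'I_n)).

Definition pair_vars ps : seq 'I_n := flatten [seq [:: p.1; p.2] | p <- ps].

Definition pair_form (c : 'I_n * 'I_n -> K) ps : E :=
  \sum_(p <- ps) c p *: (x p.1 * x p.2).

Lemma pair_form_cons c p ps :
  pair_form c (p :: ps) = pair_form c ps + c p *: (x p.1 * x p.2).
Proof. by rewrite /pair_form big_cons addrC. Qed.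

Lemma pair_form_comm c ps v : GRing.comm v (pair_form c ps).
Proof.
rewrite /GRing.comm /pair_form mulr_suml mulr_sumr; apply: eq_bigr => p _.
by rewrite -scalerAl -scalerAr ext_quad_comm.
Qed.

Lemma pair_form_free c ps i : i \notin pair_vars ps -> ext_free i (pair_form c ps).
Proof.
elim: ps => [_|p ps IH].
  by rewrite /pair_form big_nil; apply: ext_supp0.
rewrite /= !inE !negb_or => /and3P[n1 n2 ni]; rewrite pair_form_cons.
apply: ext_freeD (IH ni) _; apply: ext_suppZ.
by apply: ext_freeM; apply: ext_free_gen.
Qed.

Lemma subset_cons2 A i j s : i \notin A -> j \notin A ->
  A \subset (i :: j :: s) -> A \subset s.
Proof.
move=> iA jA /subsetP sA; apply/subsetP => l lA; have := sA l lA.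
by rewrite !inE => /or3P[/eqP e|/eqP e|//]; rewrite -e lA in iA jA.
Qed.

Lemma expr_pair h i j (c : K) m : (forall v, GRing.comm v h) ->
  (h + c *: (x i * x j)) ^+ m.+1 =
  h ^+ m.+1 + x i * x j * ((m.+1%:R * c) *: h ^+ m).
Proof.
move=> hC; have qq : x i * x j * (x i * x j) = 0.
  by rewrite mulrA -ext_quad_comm ext_gen_sq' mul0r.
elim: m => [|m IH]; first by rewrite !expr1 expr0 mul1r -scalerAr mulr1.
rewrite exprS IH mulrDl !mulrDr -!scalerAl -!scalerAr.
rewrite [x i * x j * (x i * x j * _)]mulrA qq mul0r !scaler0 addr0.
rewrite -exprS -addrA; congr (_ + _).
rewrite [h * _]mulrA -(hC (x i * x j)) -[_ * h * _]mulrA -exprS -scalerDl.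
by rewrite [m.+2%:R]mulrS mulrDl mul1r addrC.
Qed.

Lemma pair_split_supp (P : nat -> bool) p ps u :
  uniq (pair_vars (p :: ps)) ->
  ext_supp (fun A => (A \subset pair_vars (p :: ps)) && P #|A|) u ->
  exists a b c d,
  [/\ u = a + x p.1 * b + x p.2 * c + x p.1 * x p.2 * d,
      ext_supp (fun A => (A \subset pair_vars ps) && P #|A|) a,
      ext_supp (fun A => (A \subset pair_vars ps) && P #|A|.+1) b,
      ext_supp (fun A => (A \subset pair_vars ps) && P #|A|.+1) c &
      ext_supp (fun A => (A \subset pair_vars ps) && P #|A|.+2) d].
Proof.
rewrite /= inE negb_or -!andbA => /and4P[nij iV jV uV] su.
have [a [b [c [d [-> sa sb sc sd]]]]] := ext_split2 nij su.
have sU A B : B \subset p.1 :: p.2 :: pair_vars ps -> A \subset B ->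
    p.1 \notin A -> p.2 \notin A -> A \subset pair_vars ps.
  by move=> BV AB iA jA; apply: subset_cons2 iA jA (subset_trans AB BV).
exists a, b, c, d; split=> // A.
- by move=> /sa/and3P[/andP[AV ->] iA jA]; rewrite (sU A A).
- move=> /sb/and3P[/andP[AV PA] iA jA]; rewrite (sU A _ AV) ?subsetUr //=.
  by move: PA; rewrite cardsU1 iA.
- move=> /sc/and3P[/andP[AV PA] iA jA]; rewrite (sU A _ AV) ?subsetUr //=.
  by move: PA; rewrite cardsU1 jA.
move=> /sd/and3P[/andP[AV PA] iA jA].
rewrite (sU A _ AV) ?(subset_trans _ (subsetUr _ _)) ?subsetUr //=.
by move: PA; rewrite !cardsU1 !inE (negbTE nij) (negbTE iA) jA.
Qed.

Lemma ext_supp_free (P : pred {set 'I_n}) ps u i : i \notin pair_vars ps ->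
  ext_supp (fun A => (A \subset pair_vars ps) && P A) u -> ext_free i u.
Proof.
move=> iV; apply: ext_suppW => A /andP[/subsetP sA _].
by apply: contra iV => /sA.
Qed.

(** Hard Lefschetz for a sum of products of disjoint pairs of variables, by
    induction on the pairs: with h the form in the other pairs and
    u = a + x b + z c + x z d, the equation says that h^m kills a, b and c and
    that h^m d = - m h^(m-1) a; multiplying by h gives h^(m+1) d = 0, hence
    d = 0, hence h^(m-1) a = 0, hence a = 0. *)
Lemma pair_form_inj (c : 'I_n * 'I_n -> K) ps m u : uniq (pair_vars ps) ->
    {in ps, forall p, c p != 0} ->
    ext_supp (fun A => (A \subset pair_vars ps) && (#|A| + m <= size ps)%N) u ->
  pair_form c ps ^+ m * u = 0 -> u = 0.
Proof.
elim: ps m u => [|p ps IH] m u.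
  case: m => [|m] _ _ su; first by rewrite expr0 mul1r.
  by move=> _; apply: ext_supp_pred0 su => A; rewrite addnS ltn0 andbF.
case: m => [_ _ _|m uV c0 su]; first by rewrite expr0 mul1r.
have [a [b [d [e [-> sa sb sd se]]]]] :=
  @pair_split_supp (fun t => t + m.+1 <= (size ps).+1)%N _ _ _ uV su.
move: uV; rewrite /= inE negb_or -!andbA => /and4P[nij iV jV uV].
have c0' : {in ps, forall q, c q != 0}.
  by move=> q qps; apply: c0; rewrite inE qps orbT.
have hC := pair_form_comm c ps.
rewrite pair_form_cons expr_pair //.
have fr (w : E) P : ext_supp (fun A => (A \subset pair_vars ps) && P A) w ->
    ext_free p.1 w /\ ext_free p.2 w.
  by move=> sw; split; [apply: (ext_supp_free iV sw) | apply: (ext_supp_free jV sw)].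
have frh : ext_free p.1 (pair_form c ps) /\ ext_free p.2 (pair_form c ps).
  by split; apply: pair_form_free.
move/ext_pair_mul_eq0; case=> // [v|w|ha hb hd he].
- exact: (commrX m.+1 (hC v)).
- rewrite !inE; case/or4P=> [|||/or3P[]] /eqP->.
  + by case: frh; split; apply: ext_freeX.
  + by case: frh; split; apply: ext_suppZ; apply: ext_freeX.
  + exact: fr sa.
  + exact: fr sb.
  + exact: fr sd.
  + exact: fr se.
have b0 : b = 0.
  by apply: IH hb => //; apply: ext_suppW sb => A; rewrite addSn.
have d0 : d = 0.
  by apply: IH hd => //; apply: ext_suppW sd => A; rewrite addSn.
have e0 : e = 0.
  apply: (IH m.+2) => //.
    by apply: ext_suppW se => A; rewrite !addSn !addnS !ltnS.
  have := congr1 (fun v => pair_form c ps * v) he.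
  rewrite /= mulr0 mulrDr -scalerAl -scalerAr [_ * (_ ^+ m * a)]mulrA -exprS ha.
  by rewrite scaler0 addr0 mulrA -exprS.
move: he; rewrite e0 mulr0 add0r -scalerAl => /eqP.
rewrite scaler_eq0 mulf_eq0 pnatr_eq0 /= (negbTE (c0 _ (mem_head _ _))) /= => /eqP ha'.
have a0 : a = 0.
  by apply: IH ha' => //; apply: ext_suppW sa => A; rewrite addnS ltnS.
by rewrite a0 b0 d0 !mulr0 !addr0.
Qed.

Definition transversal_set ps A :=
  (A \subset pair_vars ps) && all (fun p => (p.1 \in A) (+) (p.2 \in A)) ps.

Lemma transversal_cons p ps A i j : uniq (pair_vars (p :: ps)) ->
    [set i; j] = [set p.1; p.2] ->
  transversal_set ps A -> transversal_set (p :: ps) (i |: A).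
Proof.
rewrite /transversal_set /= inE negb_or -!andbA => /and4P[nij iV jV uV] eij.
case/andP=> /subsetP AV tA.
have ip : i \in [:: p.1; p.2].
  by have : i \in [set p.1; p.2]; [rewrite -eij set21 | rewrite !inE].
have nA l : l \in [:: p.1; p.2] -> l \notin A.
  by rewrite !inE => /orP[]/eqP->; [apply: contra iV | apply: contra jV] => /AV.
apply/and3P; split.
- apply/subsetP => l; rewrite in_setU1 => /orP[/eqP->|/AV lV].
    by move: ip; rewrite !inE => /orP[]->; rewrite ?orbT.
  by rewrite !inE lV !orbT.
- rewrite !in_setU1 (negbTE (nA p.1 _)) ?inE ?eqxx //.
  rewrite (negbTE (nA p.2 _)) ?inE ?eqxx ?orbT // !orbF.
  by move: ip nij; rewrite !inE => /orP[]/eqP->; rewrite eqxx 1?eq_sym => /negbTE->.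
apply/allP => q qps; rewrite !in_setU1.
have qV l : l \in [:: q.1; q.2] -> l == i = false.
  move=> lq; apply/eqP => li; have lV : l \in pair_vars ps.
    by apply/flattenP; exists [:: q.1; q.2] => //; apply/mapP; exists q.
  move: ip; rewrite -li !inE => /orP[]/eqP e; rewrite e in lV.
    by rewrite lV in iV.
  by rewrite lV in jV.
by rewrite !qV ?inE ?eqxx ?orbT //=; apply: (allP tA).
Qed.

(** The combination of the two forms that omits a given pair (x, z) kills the
    coefficient d of x z in u; as it has no zero coefficient on the other pairs,
    it is injective on the degree in question, so d = 0. Hence the part of u
    without x and z vanishes as well, and u = x b + z c. *)
Lemma pair_pencil_annih (l : 'I_n * 'I_n -> K) ps u : uniq (pair_vars ps) ->
    {in ps &, injective l} ->
    ext_supp (fun A => (A \subset pair_vars ps) && (#|A| <= size ps)%N) u ->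
    pair_form l ps * u = 0 -> pair_form (fun=> 1) ps * u = 0 ->
  ext_supp (transversal_set ps) u.
Proof.
elim: ps u => [|p ps IH] u uV linj su.
  by move=> _ _; apply: ext_suppW su => A /andP[sA _]; rewrite /transversal_set sA.
have [a [b [c [d [-> sa sb sc sd]]]]] :=
  @pair_split_supp (fun t => t <= (size ps).+1)%N _ _ _ uV su.
have := uV; rewrite /= inE negb_or -!andbA => /and4P[nij iV jV uV'].
have fr (w : E) P : ext_supp (fun A => (A \subset pair_vars ps) && P A) w ->
    ext_free p.1 w /\ ext_free p.2 w.
  by move=> sw; split; [apply: (ext_supp_free iV sw) | apply: (ext_supp_free jV sw)].
have key e : pair_form e (p :: ps) *
      (a + x p.1 * b + x p.2 * c + x p.1 * x p.2 * d) = 0 ->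
    [/\ pair_form e ps * a = 0, pair_form e ps * b = 0, pair_form e ps * c = 0 &
        pair_form e ps * d + e p *: a = 0].
  rewrite pair_form_cons -[e p *: (_ * _)]mulr1 -scalerAl scalerAr.
  move/ext_pair_mul_eq0; case=> // [|w|-> -> ->]; first exact: pair_form_comm.
    rewrite !inE; case/or4P=> [|||/or3P[]] /eqP->.
    - by split; apply: pair_form_free.
    - by split; apply: ext_suppZ; apply: ext_supp_monom; rewrite inE.
    - exact: fr sa.
    - exact: fr sb.
    - exact: fr sc.
    - exact: fr sd.
  by rewrite -scalerAl mul1r.
move=> /key[fa fb fc fd] /key[ga gb gc gd].
have d0 : d = 0.
  apply: (@pair_form_inj (fun q => l q - l p) ps 1) => //.
  - move=> q qps; rewrite subr_eq0; apply/eqP => /linj e.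
    move: iV; rewrite -e ?inE ?eqxx ?qps ?orbT //.
    move/negP; apply; apply/flattenP; exists [:: q.1; q.2]; last by rewrite inE eqxx.
    by apply/mapP; exists q.
  - by apply: ext_suppW sd => A; rewrite addn1.
  have -> : pair_form (fun q => l q - l p) ps =
      pair_form l ps - l p *: pair_form (fun=> 1) ps.
    rewrite /pair_form scaler_sumr -sumrB; apply: eq_bigr => q _.
    by rewrite scale1r scalerBl.
  rewrite expr1 mulrBl -scalerAl.
  move: gd; rewrite scale1r => /eqP; rewrite addr_eq0 => /eqP ->.
  by rewrite scalerN opprK.
have a0 : a = 0 by move: gd; rewrite d0 mulr0 add0r scale1r.
have linj' : {in ps &, injective l}.
  by move=> q r qps rps; apply: linj; rewrite inE ?qps ?rps orbT.
have tb : ext_supp (transversal_set ps) b by apply: IH => //.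
have tc : ext_supp (transversal_set ps) c by apply: IH => //.
rewrite a0 d0 mulr0 add0r addr0; apply: ext_suppD.
- apply: (@ext_suppM _ _ (pred1 [set p.1])) tb => [A B /eqP-> tB _|].
    exact: transversal_cons tB.
  by apply: ext_supp_monom => /=.
- apply: (@ext_suppM _ _ (pred1 [set p.2])) tc => [A B /eqP-> tB _|].
    by apply: transversal_cons tB => //; rewrite setUC.
  by apply: ext_supp_monom => /=.
Qed.

(** If ps lists the pairs (x_k, z_k), ..., (x_1, z_1), these are the pairs
    (x_i, z_(i-1)), in the same order. *)
Fixpoint shifted_pairs (z0 : 'I_n) ps : seq ('I_n * 'I_n) :=
  if ps is p :: ps' then
    (p.1, head z0 [seq q.2 | q <- ps']) :: shifted_pairs z0 ps'
  else [::].

Lemma size_shifted_pairs z0 ps : size (shifted_pairs z0 ps) = size ps.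
Proof. by elim: ps => //= p ps ->. Qed.

(** The shifted pairs lose z_k and gain z_0. *)
Lemma perm_shifted_pairs z0 p ps :
  perm_eq (p.2 :: pair_vars (shifted_pairs z0 (p :: ps))) (z0 :: pair_vars (p :: ps)).
Proof.
elim: ps p => [|q ps IH] p /=.
  by apply/permP => a /=; rewrite !addn0; lia.
have := IH q; move/permP => e; apply/permP => a; have := e a => /=; lia.
Qed.

Lemma mem_shifted_pairs z0 ps :
  {subset pair_vars (shifted_pairs z0 ps) <= z0 :: pair_vars ps}.
Proof.
case: ps => [//|p ps] i iS.
by rewrite -(perm_mem (perm_shifted_pairs z0 p ps)) inE iS orbT.
Qed.

(** In the second form, z_k does not occur and the remaining variables form
    pairs, so the part of u that contains z_k vanishes; what is left is x_k b,
    and b is annihilated by the two forms of the shorter chain. *)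
Lemma odd_pencil_annih z0 ps u : uniq (z0 :: pair_vars ps) ->
    ext_supp (fun A => (A \subset z0 :: pair_vars ps) && (#|A| <= size ps)%N) u ->
    pair_form (fun=> 1) ps * u = 0 ->
    pair_form (fun=> 1) (shifted_pairs z0 ps) * u = 0 ->
  ext_supp (pred1 [set i in [seq p.1 | p <- ps]]) u.
Proof.
elim: ps u => [|p ps IH] u uV su.
  move=> _ _; apply: ext_suppW su => A /andP[_]; rewrite leqn0 cards_eq0 => /eqP->.
  by apply/eqP/setP => i; rewrite !inE.
have uS : uniq (p.2 :: pair_vars (shifted_pairs z0 (p :: ps))).
  by rewrite (perm_uniq (perm_shifted_pairs z0 p ps)).
have mS := perm_mem (perm_shifted_pairs z0 p ps).
have [[z1 z2 zV] [nij iV jV uV']] :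
    [/\ z0 != p.1, z0 != p.2 & z0 \notin pair_vars ps] /\
    [/\ p.1 != p.2, p.1 \notin pair_vars ps, p.2 \notin pair_vars ps & uniq (pair_vars ps)].
  by move: uV; rewrite /= !inE !negb_or -!andbA => /and5P[-> -> -> -> /and3P[]].
have [a [b [c [d [-> sa sb sc sd]]]]] := ext_split2 nij su.
rewrite pair_form_cons -[1 *: (_ * _)]mulr1 -scalerAl scale1r.
have fr (w : E) P : ext_supp (fun A => [&& P A, p.1 \notin A & p.2 \notin A]) w ->
    ext_free p.1 w /\ ext_free p.2 w.
  by move=> sw; split; apply: ext_suppW sw => A /and3P[].
case/ext_pair_mul_eq0=> // [|w|_ fb _ fd]; first exact: pair_form_comm.
  rewrite !inE; case/or4P=> [|||/or3P[]] /eqP->.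
  - by split; apply: pair_form_free.
  - by split; apply: ext_supp_monom; rewrite inE.
  - exact: fr sa.
  - exact: fr sb.
  - exact: fr sc.
  - exact: fr sd.
set g := pair_form _ _ => gu.
have fg : ext_free p.2 g by apply: pair_form_free; case/andP: uS.
have gE : g * (a + x p.1 * b) + x p.2 * (g * (c - x p.1 * d)) = 0.
  rewrite -[RHS]gu -[in RHS]addrA [in RHS]mulrDr; congr (_ + _).
  rewrite [LHS]mulrA (pair_form_comm _ _ (x p.2)) -mulrA; congr (_ * _).
  have zxd : x p.2 * (x p.1 * d) = - (x p.1 * x p.2 * d).
    by rewrite ext_gen_anticomm' mulrA.
  by rewrite mulrBr zxd opprK.
have fb2 w : ext_free p.2 w -> ext_free p.2 (x p.1 * w).
  by apply: ext_freeM; apply: ext_free_gen; rewrite eq_sym.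
have [_ fa] := fr _ _ sa; have [fbx fbz] := fr _ _ sb.
have [fcx fcz] := fr _ _ sc; have [fdx fdz] := fr _ _ sd.
have sN (w : E) : ext_free p.2 w -> ext_free p.2 (- w).
  by rewrite -scaleN1r; apply: ext_suppZ.
have [||ga gc] := ext_split_eq0 _ _ gE.
- by apply: ext_freeM => //; apply: ext_freeD => //; apply: fb2.
- by apply: ext_freeM => //; apply: ext_freeD => //; apply/sN/fb2.
have inS A : A \subset z0 :: pair_vars (p :: ps) -> p.2 \notin A ->
    A \subset pair_vars (shifted_pairs z0 (p :: ps)).
  move=> /subsetP sA zA; apply/subsetP => l lA; have := sA l lA.
  by rewrite -mS inE => /predU1P[e|//]; rewrite -e lA in zA.
have cd0 : c - x p.1 * d = 0.
  apply: (@pair_form_inj (fun=> 1) (shifted_pairs z0 (p :: ps)) 1) => //.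
  - by case/andP: uS.
  - by move=> q _; apply: oner_neq0.
  rewrite size_shifted_pairs /=; apply: ext_suppD.
    apply: ext_suppW sc => A /and3P[/andP[AV PA] iA jA].
    rewrite inS ?(subset_trans _ AV) ?subsetUr //=.
    by move: PA; rewrite cardsU1 jA addn1.
  rewrite -scaleN1r; apply: ext_suppZ.
  apply: (@ext_suppM _ _ (pred1 [set p.1])) sd => [A B /eqP-> /and3P[/andP[BV PB] iB jB] _|].
    rewrite inS ?(subset_trans _ BV) ?setUS ?subsetUr //=.
      by move: PB; rewrite !cardsU1 !inE (negbTE nij) iB jB /= addn1.
    by rewrite !inE negb_or eq_sym nij.
  by apply: ext_supp_monom => /=.
have [||c0 d0] := @ext_split_eq0 _ _ p.1 c (- d) fcx _ _.
- by rewrite -scaleN1r; apply: ext_suppZ.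
- by rewrite mulrN.
have {}d0 : d = 0 by rewrite -[d]opprK d0 oppr0.
have a0 : a = 0 by move: fd; rewrite d0 mulr0 add0r mul1r.
rewrite a0 c0 d0 !mulr0 !addr0 add0r in ga *.
have gb : pair_form (fun=> 1) (shifted_pairs z0 ps) * b = 0.
  have xg l : x p.1 * x l * (x p.1 * b) = 0.
    by rewrite mulrA -ext_quad_comm ext_gen_sq' mul0r.
  move: ga; rewrite /g /= pair_form_cons mulrDl -scalerAl xg scaler0 addr0.
  rewrite mulrA -pair_form_comm -mulrA -[LHS]add0r.
  move/ext_split_eq0; case=> //; first exact: ext_supp0.
  apply: ext_freeM => //; apply: pair_form_free; apply/negP => /mem_shifted_pairs.
  by rewrite inE (negbTE iV) eq_sym (negbTE z1).
have sb' : ext_supp (fun A => (A \subset z0 :: pair_vars ps) && (#|A| <= size ps)%N) b.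
  apply: ext_suppW sb => A /and3P[/andP[AV PA] iA jA]; apply/andP; split.
    have {}AV := subset_trans (subsetUr _ _) AV.
    apply/subsetP => l lA; have := subsetP AV l lA; rewrite !inE.
    by case/or4P=> [->||| ->]; rewrite ?orbT // => /eqP e; rewrite -e lA in iA jA.
  by move: PA; rewrite cardsU1 iA.
have uz : uniq (z0 :: pair_vars ps) by rewrite /= zV.
have {}IH := IH b uz sb' fb gb.
apply: (@ext_suppM _ _ (pred1 [set p.1])) IH => [A B /eqP-> /eqP-> _|].
  by apply/eqP/setP => l; rewrite !inE.
by apply: ext_supp_monom => /=.
Qed.

End SpecialPencils.



(** * Duality between the quotient and the annihilator *)

Section Duality.
Variables (K : fieldType) (n : nat).
Local Notation E := (exterior K n).
Implicit Types (f g u v w : E) (A B : {set 'I_n}) (s : seq {set 'I_n}).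

Lemma memv_span_monom s u :
  u \in <<[seq ext_monom K A | A <- s]>>%VS <-> ext_supp (mem s) u.
Proof.
split=> [us|su].
  rewrite (coord_span (X := in_tuple [seq ext_monom K A | A <- s]) us).
  apply: ext_supp_sum => i _; apply: ext_suppZ.
  have lt_i : (i < size s)%N by rewrite -(size_map (@ext_monom K n) s) ltn_ord.
  by rewrite /= (nth_map set0) //; apply: ext_supp_monom; apply: mem_nth.
rewrite (ext_sumE u); apply: rpred_sum => A _.
have [->|/su As] := eqVneq (ext_coef u A) 0; first by rewrite scale0r mem0v.
by apply/rpredZ/memv_span/map_f.
Qed.

Lemma dim_span_monom s : uniq s -> \dim <<[seq ext_monom K A | A <- s]>> = size s.
Proof.
move=> us; suff /eqnP -> : free [seq ext_monom K A | A <- s] by rewrite size_map.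
elim: s us => [|A s IH] /=; first by rewrite nil_free.
case/andP=> nAs /IH fs; rewrite free_cons fs andbT; apply/negP.
move/memv_span_monom/(_ A); rewrite ext_coef_monom eqxx oner_eq0 => /(_ isT) /= As.
by rewrite As in nAs.
Qed.

Lemma mem_ext_homog d u : u \in ext_homog K n d <-> ext_supp (fun A => #|A| == d) u.
Proof.
rewrite /ext_homog; split=> [/memv_span_monom|] su.
  by apply: ext_suppW su => A /=; rewrite mem_enum inE.
by apply/memv_span_monom; apply: ext_suppW su => A /=; rewrite mem_enum inE.
Qed.

Lemma dim_ext_homog d : \dim (ext_homog K n d) = 'C(n, d).
Proof.
rewrite dim_span_monom ?enum_uniq // -cardE.
by have := card_draws 'I_n d; rewrite card_ord.
Qed.

Lemma dim_ext_supp_le (S : {set {set 'I_n}}) (W : {vspace E}) :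
  (forall u, u \in W -> ext_supp (mem S) u) -> (\dim W <= #|S|)%N.
Proof.
move=> sW; rewrite cardE -dim_span_monom ?enum_uniq //; apply/dimvS/subvP => u /sW su.
by apply/memv_span_monom; apply: ext_suppW su => A /=; rewrite mem_enum.
Qed.

Lemma ext_homog2_comm f v : f \in ext_homog K n 2 -> GRing.comm v f.
Proof.
move/mem_ext_homog => sf; rewrite (ext_sumE f) /GRing.comm mulr_suml mulr_sumr.
apply: eq_bigr => A _.
have [->|/sf /= A2] := eqVneq (ext_coef f A) 0; first by rewrite !scale0r mul0r mulr0.
rewrite -scalerAl -scalerAr (ext_monomE K); congr (_ *: _).
move: A2; rewrite cardE; case: (enum A) => [|i [|j []]] // _.
by rewrite !big_cons big_nil mulr1 ext_quad_comm.
Qed.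

Lemma ext_coef_top w u : ext_coef (w * u) setT =
  \sum_A ext_coef w A * (ext_sign K A (~: A) * ext_coef u (~: A)).
Proof.
rewrite ext_mulE ext_coef_sum; apply: eq_bigr => A _; rewrite ext_coef_sum.
rewrite (bigD1 (~: A)) //= big1 ?addr0 => [|B nB].
  by rewrite ext_coefZ ext_coef_monom setUCr eqxx mulr1 mulrAC mulrA.
rewrite ext_coefZ ext_coef_monom /ext_sign; case: ifP => dAB; rewrite ?mulr0 ?mul0r //.
case: eqVneq => [eT|]; rewrite ?mulr0 //; case/eqP: nB.
apply/setP => i; rewrite inE; have := in_setT i; rewrite eT inE => iAB.
case: (boolP (i \in A)) iAB => [iA _|_ /= -> //].
exact: (disjointFr dAB iA).
Qed.

Lemma ext_coef_top_monom A u :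
  ext_coef (ext_monom K A * u) setT = ext_sign K A (~: A) * ext_coef u (~: A).
Proof.
rewrite ext_coef_top (bigD1 A) //= big1 ?addr0 => [|B nB].
  by rewrite ext_coef_monom eqxx mul1r.
by rewrite ext_coef_monom (negbTE nB) mul0r.
Qed.

Lemma disjointsC A : [disjoint A & ~: A].
Proof. by rewrite disjoints_subset setCK. Qed.

Lemma card_setCn A : #|~: A| = (n - #|A|)%N.
Proof. by rewrite cardsCs setCK card_ord. Qed.

Definition annih f g d : {vspace E} :=
  (ext_homog K n d :&: lker (amull f) :&: lker (amull g))%VS.

Lemma mem_annih f g d u :
  u \in annih f g d <-> [/\ ext_supp (fun A => #|A| == d) u, f * u = 0 & g * u = 0].
Proof.
rewrite /annih !memv_cap !memv_ker !lfunE /=; split.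
  by case/andP=> /andP[/mem_ext_homog ? /eqP ?] /eqP.
by case=> /mem_ext_homog -> -> ->; rewrite eqxx.
Qed.

Definition top_pairing m (w : m.-tuple E) (u : E) : 'rV[K]_m :=
  \row_i ext_coef (tnth w i * u) setT.

Lemma top_pairing_is_linear m (w : m.-tuple E) : linear (top_pairing w).
Proof.
move=> a u v; apply/rowP => i.
by rewrite !mxE mulrDr -scalerAr ext_coefD ext_coefZ.
Qed.
HB.instance Definition _ m (w : m.-tuple E) :=
  GRing.isLinear.Build K E 'rV[K]_m _ (top_pairing w) (top_pairing_is_linear w).

(** The pairing between complementary degrees is perfect: a free family of
    degree s takes prescribed values against some element of degree n - s. *)
Lemma top_pairing_onto m (w : m.-tuple E) (s : nat) : (s <= n)%N -> free w ->
    (forall i, ext_supp (fun A => #|A| == s) (tnth w i)) ->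
  (linfun (top_pairing w) @: ext_homog K n (n - s))%VS = fullv.
Proof.
move=> sn fw sw; apply/vspaceP => r; rewrite memvf; apply/memv_imgP.
pose M := \matrix_(i < m, j < #|{set 'I_n}|) ext_coef (tnth w i) (enum_val j).
have fM : row_free M.
  apply/inj_row_free => c cM.
  have e0 : \sum_(i < m) c 0 i *: w`_i = 0.
    apply: ext_coefP => A; rewrite ext_coef0 ext_coef_sum.
    have := congr1 (fun X : 'rV_ _ => X 0 (enum_rank A)) cM.
    rewrite !mxE => e; rewrite -[RHS]e; apply: eq_bigr => i _.
    by rewrite ext_coefZ mxE enum_rankK -tnth_nth.
  by apply/rowP => i; rewrite mxE; move/freeP: fw => /(_ _ e0).
pose y := pinvmx M *m r^T.
have My : M *m y = r^T by rewrite mulmxA mulmxVp // mul1mx.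
pose u : E := [ffun B : {set 'I_n} => if #|B| == (n - s)%N then
  ext_sign K (~: B) B * y (enum_rank (~: B)) 0 else 0 : K^o].
have uE B : ext_coef u B = if #|B| == (n - s)%N then
  ext_sign K (~: B) B * y (enum_rank (~: B)) 0 else 0 by exact: ffunE.
exists u; last apply/esym.
  by apply/mem_ext_homog => B; rewrite uE; case: ifP => //; rewrite eqxx.
rewrite lfunE; apply/rowP => i; rewrite mxE ext_coef_top.
have := congr1 (fun X : 'cV_ _ => X i 0) My; rewrite !mxE => <-.
rewrite [RHS](reindex (@enum_rank _)) /=; last exact/onW_bij/enum_rank_bij.
apply: eq_bigr => A _.
rewrite mxE enum_rankK uE setCK.
have [->|/sw /= /eqP As] := eqVneq (ext_coef (tnth w i) A) 0; first by rewrite !mul0r.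
by rewrite card_setCn As eqxx [_ * (_ * y _ _)]mulrA ext_sign_sq ?disjointsC // mul1r.
Qed.

Lemma ideal_gen_annih f g u w : f \in ext_homog K n 2 -> g \in ext_homog K n 2 ->
  f * u = 0 -> g * u = 0 -> w \in ideal_gen [:: f; g] -> w * u = 0.
Proof.
move=> f2 g2 fu gu; suff /subvP sI : (ideal_gen [:: f; g] <= lker (amulr u))%VS.
  by move/sI; rewrite memv_ker lfunE => /eqP.
apply/prodvP => p v pX _; rewrite memv_ker lfunE /= -mulrA.
suff /subvP sJ : ({:E} * <<[:: f; g]>> <= lker (amulr (v * u)%R))%VS.
  by move/sJ: pX; rewrite memv_ker lfunE.
apply/prodvP => a y _ yX; rewrite memv_ker lfunE /= -mulrA.
suff /subvP sX : (<<[:: f; g]>> <= lker (amulr (v * u)%R))%VS.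
  by move/sX: yX; rewrite memv_ker lfunE /= => /eqP ->; rewrite mulr0.
apply/span_subvP => h hX; rewrite memv_ker lfunE /= mulrA.
have [h2 hu] : h \in ext_homog K n 2 /\ h * u = 0.
  by move: hX; rewrite !inE => /orP[]/eqP->.
by rewrite -(ext_homog2_comm v h2) -mulrA hu mulr0.
Qed.

(** The annihilator in degree n - s is the orthogonal of the degree s part of
    the ideal for the pairing with values in degree n: if u is orthogonal to all
    v f, then f u is orthogonal to everything, hence zero. *)
Lemma dim_quot_homog f g (s : nat) : (s <= n)%N ->
    f \in ext_homog K n 2 -> g \in ext_homog K n 2 ->
  \dim (quot_homog [:: f; g] s) = \dim (annih f g (n - s)).
Proof.
move=> sn f2 g2; set I := ideal_gen [:: f; g].
pose W := (ext_homog K n s :&: I)%VS.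
have kerE : (ext_homog K n s :&: lker (linfun (@quot_proj K E [:: f; g])) = W)%VS.
  apply/vspaceP => u; rewrite !memv_cap; congr andb; rewrite memv_ker lfunE.
  rewrite -[u in RHS]subr0; apply/eqP/idP => [e|].
    by apply/quot_projP; rewrite raddf0.
  by move/quot_projP => e; rewrite /= e raddf0.
have := limg_ker_dim (linfun (@quot_proj K E [:: f; g])) (ext_homog K n s).
rewrite kerE -/(quot_homog _ _) dim_ext_homog => dimQ.
pose w := vbasis W.
have wW i : tnth w i \in W by apply/vbasis_mem/mem_tnth.
have ws i : ext_supp (fun A => #|A| == s) (tnth w i).
  by apply/mem_ext_homog; have := wW i; rewrite memv_cap => /andP[].
have := limg_ker_dim (linfun (top_pairing w)) (ext_homog K n (n - s)).
rewrite top_pairing_onto ?(basis_free (vbasisP W)) // dimvf dim_ext_homog bin_sub //.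
rewrite dim_matrix mul1r -dimQ addnC => /eqP; rewrite eqn_add2l => /eqP <-.
congr (\dim _); apply/vspaceP => u; rewrite memv_cap memv_ker lfunE /=.
apply/idP/idP => [/andP[/mem_ext_homog su /eqP u0]|/mem_annih[su fu gu]].
  have top0 v : v \in W -> ext_coef (v * u) setT = 0.
    move=> vW; rewrite (coord_vbasis vW) mulr_suml ext_coef_sum big1 // => i _.
    rewrite -scalerAl ext_coefZ; have := congr1 (fun X : 'rV_ _ => X 0 i) u0.
    by rewrite !mxE (tnth_nth 0) => ->; rewrite mulr0.
  have kill h : h \in [:: f; g] -> h * u = 0.
    move=> hX; have /mem_ext_homog h2 : h \in ext_homog K n 2.
      by move: hX; rewrite !inE => /orP[]/eqP->.
    apply: ext_coefP => A; rewrite ext_coef0; apply/eqP/negPn/negP => hA0.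
    have hu2 : ext_supp (fun A => #|A| == (2 + (n - s))%N) (h * u).
      apply: ext_suppM h2 su => B C /eqP<- /eqP<- dBC.
      by rewrite cardsU (disjoint_setI0 dBC) cards0 subn0.
    have A2 := hu2 A hA0.
    have An : (#|A| <= n)%N by rewrite -[n in (_ <= n)%N]card_ord max_card.
    move/eqP: hA0; apply; have := @ext_coef_top_monom (~: A) (h * u).
    rewrite mulrA top0.
      rewrite setCK => /esym/eqP.
      rewrite mulf_eq0 (negbTE (ext_sign_neq0 _ _)) => [/eqP //|].
      by rewrite disjoint_sym disjointsC.
    rewrite memv_cap ideal_genMl ?ideal_gen_sub // andbT; apply/mem_ext_homog.
    have sA : ext_supp (pred1 (~: A)) (ext_monom K (~: A)) by apply: ext_supp_monom => /=.
    apply: ext_suppM sA h2 => B C /eqP-> /eqP C2 dBC.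
    rewrite cardsU (disjoint_setI0 dBC) cards0 subn0 C2 card_setCn (eqP A2).
    by move: An; rewrite (eqP A2); lia.
  by apply/mem_annih; split=> //; apply: kill; rewrite !inE eqxx ?orbT.
apply/andP; split; first exact/mem_ext_homog.
apply/eqP/rowP => i; rewrite !mxE.
have := wW i; rewrite memv_cap => /andP[_ wI].
by rewrite (ideal_gen_annih f2 g2 fu gu wI) ext_coef0.
Qed.

End Duality.

(** * Genericity *)

Section Specialization.
Variables (K : numFieldType) (T : finType).
Implicit Types (c : T -> K) (q : T -> rat).

Definition eval_family c : {mpoly rat[#|T|]} -> K :=
  meval (fun i => c (enum_val i)) \o map_mpoly ratr.
HB.instance Definition _ c := GRing.RMorphism.on (eval_family c).

Lemma eval_familyX c t : eval_family c 'X_(enum_rank t) = c t.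
Proof. by rewrite /eval_family /= map_mpolyX mevalXU enum_rankK. Qed.

(** A determinant that is nonzero at one rational point is a nonzero polynomial,
    hence nonzero at every algebraically independent point. *)
Lemma generic_det_neq0 c q m (M : 'M[{mpoly rat[#|T|]}]_m) : alg_independent c ->
    \det (map_mx (meval (fun i => q (enum_val i))) M) != 0 ->
  \det (map_mx (eval_family c) M) != 0.
Proof.
rewrite !det_map_mx => cI; apply: contra_neq => /cI ->; exact: raddf0.
Qed.

End Specialization.

Section AnnihilatorMatrix.
Variables (n d : nat).
Local Notation pair_set := {A : {set 'I_n} | #|A| == 2}.
Implicit Types (A B C : {set 'I_n}).

Definition shuffle_sign (R : pzRingType) A B : R :=
  if [disjoint A & B] then (-1) ^+ #|inversions A B| else 0.

Definition annih_entry (R : pzRingType) (c : bool * pair_set -> R) A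
    (o : option bool * {set 'I_n}) : R :=
  if o.1 is Some b then
    \sum_(B : pair_set | val B :|: A == o.2) c (b, B) * shuffle_sign R (val B) A
  else ((A == o.2) && (#|A| != d))%:R.

(** Acting on row vectors indexed by the monomials, this matrix multiplies by
    both forms (columns Some b) and keeps the part outside degree d (columns
    None); its kernel is the annihilator in degree d. *)
Definition annih_mx (R : pzRingType) (c : bool * pair_set -> R) :
    'M[R]_(#|{set 'I_n}|, #|{: option bool * {set 'I_n}}|) :=
  \matrix_(i, j) annih_entry c (enum_val i) (enum_val j).

Lemma eq_annih_mx (R : pzRingType) (c c' : bool * pair_set -> R) :
  c =1 c' -> annih_mx c = annih_mx c'.
Proof.
move=> ec; apply/matrixP => i j; rewrite !mxE /annih_entry.
by case: (enum_val j).1 => [b|//]; apply: eq_bigr => B _; rewrite ec.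
Qed.

Lemma map_annih_mx (R S : pzRingType) (phi : {rmorphism R -> S}) c :
  map_mx phi (annih_mx c) = annih_mx (phi \o c).
Proof.
apply/matrixP => i j; rewrite !mxE /annih_entry.
case: (enum_val j).1 => [b|]; last exact: rmorph_nat.
rewrite rmorph_sum; apply: eq_bigr => B _; rewrite rmorphM /=; congr (_ * _).
by rewrite /shuffle_sign; case: ifP => _; rewrite ?rmorph_sign ?rmorph0.
Qed.

Variable K : fieldType.
Local Notation E := (exterior K n).
Implicit Types (f g u : E).

Definition coef_row u : 'rV[K]_#|{set 'I_n}| := \row_i ext_coef u (enum_val i).

Definition of_coef_row (r : 'rV[K]_#|{set 'I_n}|) : E :=
  [ffun A : {set 'I_n} => r 0 (enum_rank A) : K^o].

Lemma coef_row_is_linear : linear coef_row.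
Proof. by move=> a u v; apply/rowP => i; rewrite !mxE ext_coefD ext_coefZ. Qed.
HB.instance Definition _ :=
  GRing.isLinear.Build K E 'rV[K]_#|{set 'I_n}| _ coef_row coef_row_is_linear.

Lemma coef_rowK : cancel coef_row of_coef_row.
Proof.
by move=> u; apply: ext_coefP => A; rewrite /ext_coef ffunE mxE enum_rankK.
Qed.

Lemma of_coef_rowK : cancel of_coef_row coef_row.
Proof. by move=> r; apply/rowP => i; rewrite mxE /ext_coef ffunE enum_valK. Qed.

Lemma coef_quad_mul (b : bool) f g u C : f \in ext_homog K n 2 -> g \in ext_homog K n 2 ->
  ext_coef ((if b then f else g) * u) C =
  \sum_A ext_coef u A * annih_entry (quadratic_coefs f g) A (Some b, C).
Proof.
move=> f2 g2; set h := if b then f else g.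
have /mem_ext_homog h2 : h \in ext_homog K n 2 by rewrite /h; case: (b).
have hE : h = \sum_(B : pair_set) ext_coef h (val B) *: ext_monom K (val B).
  rewrite {1}(ext_sumE h) (bigID (fun A => #|A| == 2)) /= addrC big1 ?add0r; last first.
    by move=> A nA; rewrite (ext_supp_coef0 h2) // scale0r.
  rewrite (reindex_omap (val : pair_set -> {set 'I_n}) insub) => [|A A2]; last by rewrite insubT.
  by apply: eq_bigl => B; rewrite (valP B) valK eqxx.
transitivity (\sum_(B : pair_set) \sum_A ext_coef u A *
    (ext_coef h (val B) * (shuffle_sign K (val B) A * (val B :|: A == C)%:R))).
  rewrite {1}hE mulr_suml ext_coef_sum; apply: eq_bigr => B _.
  rewrite {1}(ext_sumE u) mulr_sumr ext_coef_sum; apply: eq_bigr => A _.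
  rewrite -scalerAl -scalerAr [ext_monom K _ * _](ext_monomM K) !ext_coefZ ext_coef_monom.
  by rewrite [C == _]eq_sym mulrCA.
rewrite exchange_big; apply: eq_bigr => A _; rewrite -mulr_sumr /annih_entry /=.
congr (_ * _); rewrite [RHS]big_mkcond; apply: eq_bigr => B _ /=.
rewrite /quadratic_coefs /h; case: (b) => /=; case: eqP => _; by rewrite ?mulr1 ?mulr0.
Qed.

Lemma mem_annih_mx f g u : f \in ext_homog K n 2 -> g \in ext_homog K n 2 ->
  u \in annih f g d <-> coef_row u *m annih_mx (quadratic_coefs f g) = 0.
Proof.
move=> f2 g2.
have entry (o : option bool * {set 'I_n}) :
    (coef_row u *m annih_mx (quadratic_coefs f g)) 0 (enum_rank o) =
    \sum_A ext_coef u A * annih_entry (quadratic_coefs f g) A o.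
  rewrite mxE (reindex (@enum_rank _)) /=; last exact/onW_bij/enum_rank_bij.
  by apply: eq_bigr => A _; rewrite !mxE !enum_rankK.
have entryN C : \sum_A ext_coef u A * annih_entry (quadratic_coefs f g) A (None, C)
    = ext_coef u C * (#|C| != d)%:R.
  rewrite (bigD1 C) //= big1 ?addr0 => [|A nA]; first by rewrite /annih_entry eqxx.
  by rewrite /annih_entry (negbTE nA) mulr0.
split=> [/mem_annih[su fu gu]|e0].
  apply/rowP => i; rewrite -(enum_valK i) entry mxE.
  case: (enum_val i) => [[b|] C].
    by rewrite -(coef_quad_mul _ _ _ f2 g2); case: b; rewrite ?fu ?gu ext_coef0.
  rewrite entryN; have [|nC] := boolP (#|C| == d); first by rewrite mulr0.
  by rewrite (ext_supp_coef0 su) // mul0r.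
have {}e0 o : \sum_A ext_coef u A * annih_entry (quadratic_coefs f g) A o = 0.
  by rewrite -entry e0 mxE.
apply/mem_annih; split.
- move=> A; apply: contraNT => nA; have := e0 (None, A).
  by rewrite entryN nA mulr1 => ->.
- by apply: ext_coefP => C; rewrite (coef_quad_mul true _ _ f2 g2) e0 ext_coef0.
- by apply: ext_coefP => C; rewrite (coef_quad_mul false _ _ f2 g2) e0 ext_coef0.
Qed.

Lemma dim_annih_mx f g : f \in ext_homog K n 2 -> g \in ext_homog K n 2 ->
  \dim (annih f g d) = (#|{set 'I_n}| - \rank (annih_mx (quadratic_coefs f g)))%N.
Proof.
move=> f2 g2; set W := annih _ _ _; set M := annih_mx _.
rewrite -mxrank_ker; apply/eqP; rewrite eqn_leq; apply/andP; split.
  pose B := \matrix_(i < \dim W) coef_row (tnth (vbasis W) i).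
  have fB : row_free B.
    apply/inj_row_free => c cB.
    have e0 : \sum_(i < \dim W) c 0 i *: (vbasis W)`_i = 0.
      apply: (can_inj coef_rowK); rewrite raddf0 -[RHS]cB mulmx_sum_row linear_sum.
      by apply: eq_bigr => i _; rewrite linearZ /= rowK -tnth_nth.
    apply/rowP => i; rewrite mxE; have /freeP := basis_free (vbasisP W).
    by move=> /(_ _ e0).
  rewrite -(eqP fB); apply: mxrankS; apply/sub_kermxP/row_matrixP => i.
  rewrite row_mul rowK row0; apply/mem_annih_mx => //.
  exact/vbasis_mem/mem_tnth.
pose B := row_base (kermx M).
pose X := [tuple of_coef_row (row i B) | i < \rank (kermx M)].
have fX : free X.
  apply/freeP => c e0 i.
  have : (\row_i c i) *m B = 0.
    rewrite mulmx_sum_row -[RHS](raddf0 coef_row) -e0 raddf_sum.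
    apply: eq_bigr => j _.
    by rewrite -tnth_nth tnth_mktuple [RHS]linearZ /= of_coef_rowK mxE.
  move/eqP; rewrite mulmx_free_eq0 ?row_base_free // => /eqP/rowP/(_ i).
  by rewrite !mxE.
rewrite -(size_tuple X) -(eqP fX); apply/dimvS/span_subvP => u /mapP[i _ ->].
apply/mem_annih_mx => //; rewrite of_coef_rowK -row_mul.
by rewrite (_ : B *m M = 0) ?row0 //; apply/sub_kermxP; rewrite eq_row_base.
Qed.

End AnnihilatorMatrix.

Section Semicontinuity.

Lemma unit_minor (F : fieldType) m n (A : 'M[F]_(m, n)) :
  exists (h : 'I_(\rank A) -> 'I_m) (k : 'I_(\rank A) -> 'I_n), mxsub h k A \in unitmx.
Proof.
pose B := rowsub (maxrankfun A) A.
have fB : row_full B^T by rewrite /row_full mxrank_tr; apply: maxrowsub_free.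
exists (maxrankfun A), (fullrankfun fB).
rewrite -unitmx_tr (_ : _^T = rowsub (fullrankfun fB) B^T) ?fullrowsub_unit //.
by apply/matrixP => i j; rewrite !mxE.
Qed.

Lemma unit_minor_rank (F : fieldType) m n r (A : 'M[F]_(m, n)) h k :
  mxsub h k A \in @unitmx F r -> (r <= \rank A)%N.
Proof.
move=> /mxrank_unit {1}<-; rewrite mxsubrc.
apply: leq_trans (mxrankS (rowsub_sub _ _)) _.
by rewrite -mxrank_tr trmx_mxsub -[X in (_ <= X)%N]mxrank_tr; apply/mxrankS/rowsub_sub.
Qed.

(** The annihilator of a generic pair is as small as possible: a minor of
    maximal size of the matrix at a rational pair does not vanish identically. *)
Lemma generic_dim_annih_le (K : numFieldType) n d (f g : exterior K n)
    (f0 g0 : exterior rat n) : generic_quadratic_pair f g ->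
    f0 \in ext_homog rat n 2 -> g0 \in ext_homog rat n 2 ->
  (\dim (annih f g d) <= \dim (annih f0 g0 d))%N.
Proof.
case=> f2 g2 indep f02 g02; rewrite !dim_annih_mx //; apply: leq_sub2l.
set M0 := annih_mx _ (quadratic_coefs f0 g0).
have [h [k]] := unit_minor M0.
pose MX := annih_mx d (fun t =>
  'X_(enum_rank t) : {mpoly rat[#|{: bool * {A : {set 'I_n} | #|A| == 2}}|]}).
rewrite unitmxE unitfE => det0; apply: (@unit_minor_rank _ _ _ _ _ h k).
rewrite unitmxE unitfE.
have := @generic_det_neq0 _ _ _ (quadratic_coefs f0 g0) _ (mxsub h k MX) indep.
rewrite !map_mxsub !map_annih_mx.
rewrite (@eq_annih_mx _ _ _ _ (quadratic_coefs f0 g0)) => [|t /=]; last first.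
  by rewrite mevalXU enum_rankK.
rewrite (@eq_annih_mx _ _ _ _ (quadratic_coefs f g)) => [|t /=]; last first.
  exact: eval_familyX.
exact.
Qed.

End Semicontinuity.

(** * Products of linear forms in the annihilator *)

Section AnticommutingProducts.
Variables (R : pzRingType) (I : eqType) (y : I -> R).
Hypothesis yy : forall i j, y i * y j = - (y j * y i).

Lemma anticomm_prod_rem i s : i \in s -> exists b : bool,
  \prod_(j <- s) y j = (-1) ^+ b * (y i * \prod_(j <- rem i s) y j).
Proof.
elim: s => //= k s IH; rewrite inE eq_sym; case: eqVneq => [-> _|nik /= /IH[b e]].
  by exists false; rewrite big_cons mul1r.
have sw p : y k * (y i * p) = - (y i * (y k * p)) by rewrite mulrA yy mulNr -mulrA.
exists (~~ b); rewrite !big_cons e [LHS]mulrA commr_sign -[LHS]mulrA sw.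
by rewrite signrN mulNr mulrN.
Qed.

Lemma anticomm_prod_perm s t : perm_eq s t -> exists b : bool,
  \prod_(j <- s) y j = (-1) ^+ b * \prod_(j <- t) y j.
Proof.
elim: s t => [|i s IH] t pst.
  by exists false; rewrite mul1r; congr bigop; apply/esym/perm_nilP; rewrite perm_sym.
have it : i \in t by rewrite -(perm_mem pst) mem_head.
have [b ->] := anticomm_prod_rem it.
have [|b' e] := IH (rem i t).
  by rewrite -(perm_cons i) (perm_trans pst) // perm_to_rem.
exists (b' (+) b); rewrite big_cons e signr_addb [LHS]mulrA commr_sign.
by rewrite -[RHS]mulrA signrMK mulrA.
Qed.

Lemma anticomm_mul_prod i s : y i * y i = 0 -> i \in s -> y i * \prod_(j <- s) y j = 0.
Proof.
move=> sq /anticomm_prod_rem[b ->].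
by rewrite mulrA commr_sign -mulrA [y i * _]mulrA sq mul0r mulr0.
Qed.

End AnticommutingProducts.

Section LinearChange.
Variables (K : numFieldType) (n : nat).
Local Notation E := (exterior K n).
Local Notation x := (ext_gen K).
Implicit Types (f g u : E) (A T : {set 'I_n}) (F P : 'M[K]_n).

(** Normalized so that f is half the sum of all gram f i j x_i x_j. *)
Definition gram f : 'M[K]_n := \matrix_(i, j)
  if (i < j)%N then ext_coef f [set i; j]
  else if (j < i)%N then - ext_coef f [set i; j] else 0.

Lemma gram_skew f : (gram f)^T = - gram f.
Proof.
apply/matrixP => i j; rewrite !mxE setUC.
by case: ltngtP => _; rewrite ?opprK ?oppr0.
Qed.

Lemma ext_gen_lt (i j : 'I_n) : (i < j)%N -> x i * x j = ext_monom K [set i; j].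
Proof.
move=> ij; have /negbTE nij : i != j by rewrite neq_ltn ij.
rewrite [LHS]ext_gen_monom inE nij.
rewrite /ext_sign disjoints1 inE neq_ltn ij /= (_ : #|_| = 0)%N ?expr0 ?scale1r //.
apply: eq_card0 => -[a b]; rewrite !inE /=; apply/and3P => -[/eqP-> /eqP->].
by rewrite ltnNge ltnW.
Qed.

Lemma gram_formE f : f \in ext_homog K n 2 ->
  \sum_i \sum_j gram f i j *: (x i * x j) = 2%:R *: f.
Proof.
move/mem_ext_homog => f2.
have gE i j : gram f i j *: (x i * x j) =
    if i == j then 0 else ext_coef f [set i; j] *: ext_monom K [set i; j].
  rewrite mxE -val_eqE; case: ltngtP => [ij|ji|_]; last by rewrite scale0r.
    by rewrite ext_gen_lt.
  by rewrite ext_gen_anticomm ext_gen_lt // scaleNr scalerN opprK [[set j; i]]setUC.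
under eq_bigr => i _ do under eq_bigr => j _ do rewrite gE.
apply: ext_coefP => A; rewrite ext_coefZ ext_coef_sum.
under eq_bigr do rewrite ext_coef_sum.
have [/cards2P[a [b [nab ->]]]|A2] := boolP (#|A| == 2); last first.
  rewrite (ext_supp_coef0 f2) // mulr0 big1 // => i _; rewrite big1 // => j _.
  case: eqVneq => ij; first by rewrite ext_coef0.
  rewrite ext_coefZ ext_coef_monom; case: eqVneq => [e|]; last by rewrite mulr0.
  by rewrite e cards2 ij in A2.
have termE i j : ext_coef (if i == j then 0 else
      ext_coef f [set i; j] *: ext_monom K [set i; j]) [set a; b] =
    ext_coef f [set a; b] * (((i == a) && (j == b))%:R + ((i == b) && (j == a))%:R).
  have [<-|nij] := eqVneq i j.
    rewrite ext_coef0; case: (eqVneq i a) => [->|]; last by rewrite andbF addr0 mulr0.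
    by rewrite (negbTE nab) addr0 mulr0.
  rewrite ext_coefZ ext_coef_monom; case: eqVneq => [e|ne].
    rewrite -e; congr (_ * _).
    have : i \in [set a; b] by rewrite e set21.
    have : j \in [set a; b] by rewrite e set22.
    rewrite !inE => /orP[] /eqP ej /orP[] /eqP ei; rewrite ei ej ?eqxx in nij *.
    - by [].
    - by rewrite eq_sym (negbTE nab) /= add0r.
    - by rewrite (negbTE nab) /= addr0.
    - by [].
  rewrite mulr0; case: andP => [[/eqP ei /eqP ej]|_]; first by rewrite ei ej eqxx in ne.
  case: andP => [[/eqP ei /eqP ej]|_]; last by rewrite addr0 mulr0.
  by rewrite ei ej setUC eqxx in ne.
under eq_bigr => i _ do under eq_bigr => j _ do rewrite termE.
under eq_bigr do rewrite -mulr_sumr; rewrite -mulr_sumr mulrC; congr (_ * _).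
have one p q : \sum_i \sum_j ((i == p) && (j == q))%:R = 1 :> K.
  rewrite (bigD1 p) //= [X in _ + X]big1 ?addr0 => [|i /negbTE ni]; last first.
    by rewrite big1 // => j _; rewrite ni.
  rewrite (bigD1 q) //= big1 ?addr0 => [|j /negbTE nj]; first by rewrite !eqxx.
  by rewrite nj andbF.
under eq_bigr do rewrite big_split; rewrite big_split /= !one.
by rewrite -[1 + 1]/(2%:R).
Qed.

Section Change.
Variable P : 'M[K]_n.
Hypothesis uP : P \in unitmx.

(** The basis of linear forms in which a form with matrix F has the matrix
    P F P^T. *)
Definition new_gen i : E := \sum_j invmx P j i *: x j.

Lemma ext_gen_new j : x j = \sum_i P i j *: new_gen i.
Proof.
under eq_bigr do rewrite scaler_sumr; rewrite exchange_big /=.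
rewrite (bigD1 j) //= [X in _ + X]big1 ?addr0 => [|l nlj].
  under eq_bigr do rewrite scalerA; rewrite -scaler_suml.
  have /matrixP/(_ j j) := mulVmx uP; rewrite !mxE eqxx => e.
  by under eq_bigr do rewrite mulrC; rewrite e scale1r.
under eq_bigr do rewrite scalerA; rewrite -scaler_suml.
have /matrixP/(_ l j) := mulVmx uP; rewrite !mxE (negbTE nlj) => e.
by under eq_bigr do rewrite mulrC; rewrite e scale0r.
Qed.

Lemma new_gen_anticomm i j : new_gen i * new_gen j = - (new_gen j * new_gen i).
Proof.
rewrite /new_gen mulr_suml mulr_suml -sumrN.
under eq_bigr do rewrite mulr_sumr; under [RHS]eq_bigr do rewrite mulr_sumr -sumrN.
rewrite exchange_big; apply: eq_bigr => a _; apply: eq_bigr => b _ /=.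
by rewrite -!scalerAl -!scalerAr ext_gen_anticomm !scalerN !scalerA mulrC.
Qed.

Lemma new_gen_sq i : new_gen i * new_gen i = 0.
Proof.
have /eqP := new_gen_anticomm i i; rewrite -addr_eq0 -mulr2n -scaler_nat scaler_eq0.
by rewrite pnatr_eq0 /= => /eqP.
Qed.

Definition new_monom A : E := \prod_(i <- enum A) new_gen i.

Lemma new_monom_homog A : new_monom A \in ext_homog K n #|A|.
Proof.
apply/mem_ext_homog; rewrite /new_monom cardE; elim: (enum A) => [|i s IH].
  by rewrite big_nil; apply: ext_supp_monom; rewrite cards0.
rewrite big_cons; apply: (@ext_suppM _ _ (fun A => #|A| == 1)) IH.
  move=> B C /eqP B1 /eqP Cs dBC.
  by rewrite cardsU (disjoint_setI0 dBC) cards0 subn0 B1 Cs.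
apply: ext_supp_sum => j _; apply: ext_suppZ; apply: ext_supp_monom.
by rewrite cards1.
Qed.

(** Their span contains 1 and is stable under multiplication by every new
    generator, hence by every x_j. *)
Lemma free_new_monom : free [seq new_monom A | A <- enum {set 'I_n}].
Proof.
set X := map _ _; set W := <<X>>%VS.
have mW A : new_monom A \in W by apply/memv_span/map_f; rewrite mem_enum.
have genW i u : u \in W -> new_gen i * u \in W.
  move=> uW; rewrite (coord_span (X := in_tuple X) uW) mulr_sumr.
  apply: rpred_sum => k _; rewrite -scalerAr; apply: rpredZ.
  have : (in_tuple X)`_k \in X by apply: mem_nth; apply: ltn_ord.
  case/mapP=> A _ ->; have [iA|iA] := boolP (i \in A).
    rewrite (anticomm_mul_prod new_gen_anticomm (new_gen_sq i)) ?mem0v //.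
    by rewrite mem_enum.
  have pU : perm_eq (i :: enum A) (enum (i |: A)).
    apply: uniq_perm; rewrite /= ?enum_uniq ?mem_enum ?iA // => j.
    by rewrite inE !mem_enum in_setU1.
  have [b e] := anticomm_prod_perm new_gen_anticomm pU.
  rewrite big_cons in e; rewrite e.
  by case: (b); rewrite ?mulN1r ?mul1r ?rpredN; apply: mW.
have W1 : 1 \in W.
  by have := mW set0; rewrite /new_monom enum_set0 big_nil.
have monomW A : ext_monom K A \in W.
  rewrite (ext_monomE K); elim: (enum A) => [|j s IH]; first by rewrite big_nil.
  rewrite big_cons ext_gen_new mulr_suml; apply: rpred_sum => i _.
  by rewrite -scalerAl; apply/rpredZ/genW.
rewrite /free size_map eqn_leq -[X in (_ <= X)%N](size_map new_monom) dim_span /=.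
rewrite -(@dim_span_monom K n (enum {set 'I_n})) ?enum_uniq //.
apply/dimvS/span_subvP => u /mapP[A _ ->]; exact: monomW.
Qed.

Lemma gram_form_new f : f \in ext_homog K n 2 ->
  2%:R *: f = \sum_i \sum_j (P *m gram f *m P^T) i j *: (new_gen i * new_gen j).
Proof.
move=> f2; rewrite -gram_formE //.
transitivity (\sum_a \sum_b \sum_i \sum_j
    (P i a * gram f a b * P j b) *: (new_gen i * new_gen j)).
  apply: eq_bigr => a _; apply: eq_bigr => b _.
  rewrite (ext_gen_new a) (ext_gen_new b) mulr_suml scaler_sumr.
  apply: eq_bigr => i _; rewrite mulr_sumr scaler_sumr; apply: eq_bigr => j _.
  by rewrite -scalerAl -scalerAr !scalerA [gram f a b * _]mulrC.
under eq_bigr do rewrite exchange_big; rewrite exchange_big; apply: eq_bigr => i _ /=.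
under eq_bigr do rewrite exchange_big; rewrite exchange_big; apply: eq_bigr => j _ /=.
rewrite exchange_big /= mxE scaler_suml; apply: eq_bigr => b _.
by rewrite mxE mulr_suml scaler_suml; apply: eq_bigr => a _; rewrite [P^T _ _]mxE.
Qed.

(** Every term of the form contains a factor of the product. *)
Lemma gram_mul_new_monom f T : f \in ext_homog K n 2 ->
    (forall i j, i \notin T -> j \notin T -> (P *m gram f *m P^T) i j = 0) ->
  f * new_monom T = 0.
Proof.
move=> f2 fT; apply: (scalerI (a := 2%:R)); first by rewrite pnatr_eq0.
rewrite scaler0 scalerAl gram_form_new // mulr_suml big1 // => i _.
rewrite mulr_suml big1 // => j _; rewrite -scalerAl.
have kill l : l \in T -> new_gen l * new_monom T = 0.
  move=> lT; apply: anticomm_mul_prod (new_gen_sq l) _; last by rewrite mem_enum.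
  exact: new_gen_anticomm.
have [jT|jT] := boolP (j \in T); first by rewrite -mulrA kill // mulr0 scaler0.
have [iT|iT] := boolP (i \in T); last by rewrite fT // scale0r.
by rewrite new_gen_anticomm mulNr -mulrA kill // mulr0 oppr0 scaler0.
Qed.

Lemma annih_ge f g d (S : {set {set 'I_n}}) :
    f \in ext_homog K n 2 -> g \in ext_homog K n 2 ->
    (forall T, T \in S -> #|T| = d /\ forall i j, i \notin T -> j \notin T ->
       (P *m gram f *m P^T) i j = 0 /\ (P *m gram g *m P^T) i j = 0) ->
  (#|S| <= \dim (annih f g d))%N.
Proof.
move=> f2 g2 ST; pose X := [seq new_monom A | A <- enum S].
have fX : free X.
  have pS : perm_eq (enum {set 'I_n}) (enum S ++ enum (~: S)).
    apply: uniq_perm; rewrite ?enum_uniq //.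
      rewrite cat_uniq !enum_uniq andbT /=; apply/hasPn => A.
      by rewrite !mem_enum inE.
    by move=> A; rewrite mem_cat !mem_enum !inE orbN.
  by have := free_new_monom; rewrite (perm_free (perm_map _ pS)) map_cat => /catl_free.
rewrite cardE -(size_map new_monom) -(eqP fX); apply/dimvS/span_subvP => u /mapP[T].
rewrite mem_enum => /ST[Td Tij] ->; apply/mem_annih; split.
- by apply/mem_ext_homog; rewrite -Td new_monom_homog.
- by apply: gram_mul_new_monom => // i j iT jT; case: (Tij i j).
- by apply: gram_mul_new_monom => // i j iT jT; case: (Tij i j).
Qed.

End Change.

End LinearChange.

(** * Pairs of skew-symmetric matrices *)

Section Skew.
Variable K : numFieldType.

Lemma skew_odd_kernel n (A : 'M[K]_n) : odd n -> A^T = - A ->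
  exists2 v : 'rV_n, v != 0 & v *m A = 0.
Proof.
move=> on sA; apply/det0P; have := det_tr A; rewrite sA -scaleN1r detZ -signr_odd on.
rewrite expr1 mulN1r => /eqP; rewrite eq_sym -addr_eq0 -mulr2n -mulr_natl mulf_eq0.
by rewrite pnatr_eq0.
Qed.

Lemma skew_mul m n (A : 'M[K]_n) (V : 'M_(m, n)) :
  A^T = - A -> (V *m A *m V^T)^T = - (V *m A *m V^T).
Proof. by move=> sA; rewrite !trmx_mul trmxK sA mulNmx mulmxN mulmxA. Qed.

Lemma skew_row_sq n (A : 'M[K]_n) (v : 'rV_n) : A^T = - A -> v *m A *m v^T = 0.
Proof.
move=> /(skew_mul v) /matrixP/(_ 0 0); rewrite [LHS]mxE [RHS]mxE => /eqP.
rewrite -addr_eq0 -mulr2n -mulr_natl mulf_eq0 pnatr_eq0 /= => /eqP e.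
by apply/matrixP => i j; rewrite !ord1 e mxE.
Qed.

Lemma skew_swap0 m1 m2 n (A : 'M[K]_n) (V : 'M_(m1, n)) (W : 'M_(m2, n)) :
  A^T = - A -> V *m A *m W^T = 0 -> W *m A *m V^T = 0.
Proof.
move=> sA e; apply: trmx_inj; rewrite !trmx_mul trmxK sA mulNmx mulmxN mulmxA e.
by rewrite oppr0 trmx0.
Qed.

Lemma row_free_subset r m n (A : 'M[K]_(m, n)) : (r <= \rank A)%N ->
  exists2 C : 'M_(r, n), row_free C & (C <= A)%MS.
Proof.
move=> rA; exists (pid_mx r *m row_base A).
  by rewrite /row_free mxrankMfree ?row_base_free // rank_pid_mx.
by rewrite -(eq_row_base A) submxMl.
Qed.

Lemma col_mx_free m1 m2 n (V : 'M[K]_(m1, n)) (W : 'M_(m2, n)) :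
  row_free V -> row_free W -> (V :&: W)%MS = 0 -> row_free (col_mx V W).
Proof.
move=> fV fW VW; rewrite /row_free -addsmxE mxrank_disjoint_sum //.
by rewrite (eqP fV) (eqP fW).
Qed.

Lemma row_free_row n (v : 'rV[K]_n) : v != 0 -> row_free v.
Proof. by rewrite /row_free rank_rV => ->. Qed.

(** A kernel vector v of the first matrix lies in its own orthogonal for the
    second; a complement of v in that orthogonal, of dimension n - 2, contains
    an isotropic subspace by induction, and v can be added to it. *)
Lemma skew_odd_isotropic k (A B : 'M[K]_(k.*2.+1)) : A^T = - A -> B^T = - B ->
  exists V : 'M_(k.+1, k.*2.+1),
    [/\ row_free V, V *m A *m V^T = 0 & V *m B *m V^T = 0].
Proof.
elim: k A B => [|k IH] A B sA sB.
  exists 1%:M; split; rewrite ?row_free_unit ?unitmx1 // trmx1 mulmx1 mul1mx.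
    by rewrite -[A]mul1mx -[_ *m A]mulmx1 -[X in _ *m X]trmx1 skew_row_sq.
  by rewrite -[B]mul1mx -[_ *m B]mulmx1 -[X in _ *m X]trmx1 skew_row_sq.
have [|v v0 vA] := skew_odd_kernel _ sA; first by rewrite /= odd_double.
pose W := kermx (B *m v^T); pose U := (W :\: v)%MS.
have rU : (k.*2.+1 <= \rank U)%N.
  have := mxrank_cap_compl W v; rewrite mxrank_ker.
  have : (\rank (W :&: v)%MS <= 1)%N.
    by rewrite (leq_trans (mxrankS (capmxSr _ _))) // rank_rV v0.
  have : (\rank (B *m v^T) <= 1)%N by apply: rank_leq_col.
  rewrite -/U; have := doubleS k; lia.
have [C fC CU] := row_free_subset rU.
have CBv : C *m B *m v^T = 0.
  by rewrite -mulmxA; apply/sub_kermxP/(submx_trans CU)/diffmxSl.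
have CAv : C *m A *m v^T = 0 by apply: (skew_swap0 sA); rewrite vA mul0mx.
have [V [fV VA VB]] := IH _ _ (skew_mul C sA) (skew_mul C sB).
have iso X : X^T = - X -> C *m X *m v^T = 0 -> V *m (C *m X *m C^T) *m V^T = 0 ->
    col_mx v (V *m C) *m X *m (col_mx v (V *m C))^T = 0.
  move=> sX CXv VX; rewrite mul_col_mx tr_col_mx mul_col_row skew_row_sq //.
  have e : V *m C *m X *m v^T = 0 by rewrite -!mulmxA [C *m _]mulmxA CXv mulmx0.
  rewrite e (skew_swap0 sX e) trmx_mul !mulmxA.
  by rewrite !mulmxA in VX; rewrite VX block_mx_const.
exists (col_mx v (V *m C)); split; last 2 first.
- exact: iso.
- exact: iso.
apply: (@col_mx_free 1 k.+1); first exact: row_free_row.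
  by rewrite /row_free mxrankMfree // (eqP fV).
apply/eqP; rewrite -submx0 -(capmx_diff W v) sub_capmx capmxSl andbT.
by rewrite (submx_trans (capmxSr _ _)) // (submx_trans (submxMl _ _)).
Qed.

Lemma row_ebase_sub m n (V : 'M[K]_(m, n)) (i : 'I_n) : (i < \rank V)%N ->
  (row i (row_ebase V) <= V)%MS.
Proof.
move=> iV; rewrite -(eq_row_base V).
rewrite (_ : row i _ = row (Ordinal iV) (row_base V)) ?row_sub //.
rewrite /row_base row_mul [LHS]rowE; congr (_ *m _); apply/rowP => j; rewrite !mxE /= iV.
by rewrite andbT eq_sym.
Qed.

Lemma mx_row_entry n (P A : 'M[K]_n) i j :
  (P *m A *m P^T) i j = (row i P *m A *m (row j P)^T) 0 0.
Proof. by rewrite -row_mul !mxE; apply: eq_bigr => l _; rewrite !mxE. Qed.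

Lemma skew_odd_normal k (A B : 'M[K]_(k.*2.+1)) : A^T = - A -> B^T = - B ->
  exists2 P : 'M_(k.*2.+1), P \in unitmx &
    forall i j : 'I__, (i <= k)%N -> (j <= k)%N ->
      (P *m A *m P^T) i j = 0 /\ (P *m B *m P^T) i j = 0.
Proof.
move=> sA sB; have [V [/eqP fV VA VB]] := skew_odd_isotropic sA sB.
exists (row_ebase V) => [|i j ik jk]; first exact: row_ebase_unit.
have := @row_ebase_sub _ _ V i; rewrite fV ltnS => /(_ ik) /submxP[a ea].
have := @row_ebase_sub _ _ V j; rewrite fV ltnS => /(_ jk) /submxP[b eb].
have z X : V *m X *m V^T = 0 -> row i (row_ebase V) *m X *m (row j (row_ebase V))^T = 0.
  move=> VX; rewrite ea eb trmx_mul !mulmxA.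
  by rewrite -2![a *m _ *m _]mulmxA VX mulmx0 mul0mx.
by split; rewrite mx_row_entry z // mxE.
Qed.

(** The kernel of a skew-symmetric matrix of even size has even dimension: if
    v spanned it, restricting to a complement of v would give an invertible
    skew-symmetric matrix of odd size. *)
Lemma skew_even_kernel n (A : 'M[K]_n) : ~~ odd n -> A^T = - A -> \det A = 0 ->
  exists2 Y : 'M_(2, n), row_free Y & Y *m A = 0.
Proof.
move=> en sA /eqP/det0P[v v0 vA].
pose C := row_base (v^C)%MS.
have rC : \rank (v^C)%MS = n.-1 by rewrite mxrank_compl rank_rV v0 subn1.
have on : odd (\rank (v^C)%MS).
  rewrite rC; case: n en v v0 {A sA vA C rC} => [|n] //= en v.
    by rewrite [v]thinmx0 eqxx.
  by rewrite negbK in en.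
have [w w0 wC] := skew_odd_kernel on (skew_mul C sA).
have wCA : w *m C *m A = 0.
  apply/trmx_inj/eqP; rewrite trmx0 -submx0 -[X in (X <= _)%MS]mul1mx.
  set X := (_ *m A)^T; suff : (1%:M <= kermx X)%MS by rewrite sub_kermx submx0.
  apply: (@submx_trans _ _ _ _ _ _ (v + v^C)%MS).
    by rewrite submx_full ?addsmx_compl_full.
  rewrite addsmx_sub; apply/andP; split.
    rewrite sub_kermx /X trmx_mul sA mulNmx mulmxN mulmxA vA mul0mx oppr0 //.
  rewrite -eq_row_base sub_kermx -/C; apply/eqP/trmx_inj.
  by rewrite trmx_mul trmxK trmx0 -[RHS]wC !mulmxA.
exists (col_mx v (w *m C)).
  apply: (@col_mx_free 1 1); rewrite ?row_free_row //.
    by rewrite mulmx_free_eq0 ?row_base_free.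
  apply/eqP; rewrite -submx0 -(capmx_compl v); apply: capmxS => //.
  by rewrite (submx_trans (submxMl _ _)) // eq_row_base.
by rewrite (@mul_col_mx _ 1 1) vA wCA col_mx0.
Qed.

End Skew.

Section EvenPencils.
Variable K : numFieldType.

Lemma eigenvectors_direct n (M : 'M[K]_n) (I : finType) (l : I -> K) (w : I -> 'rV_n) :
    injective l -> (forall p, w p *m M = l p *: w p) -> \sum_p w p = 0 ->
  forall p, w p = 0.
Proof.
move=> linj wM w0 p; have inj : {in predT &, injective l} by move=> ? ? _ _ /linj.
have /mxdirect_sumsP/(_ p isT) := mxdirect_sum_eigenspace M inj.
have we q : (w q <= eigenspace M (l q))%MS by apply/eigenspaceP.
move=> cap0; apply/eqP; rewrite -submx0 -cap0 sub_capmx we /=.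
move: w0; rewrite (bigD1 p) //= => /eqP; rewrite addr_eq0 => /eqP ->.
by rewrite eqmx_opp; apply: summx_sub_sums.
Qed.

Lemma half_ltn k (i : 'I_k.*2) : (i./2 < k)%N.
Proof. by have := ltn_ord i; have := odd_double_half i; lia. Qed.

Definition pair_of k (i : 'I_k.*2) : 'I_k := Ordinal (half_ltn i).

Lemma pair_of_inj k (i j : 'I_k.*2) : pair_of i = pair_of j -> odd i = odd j -> i = j.
Proof.
move=> [ij] oij; apply/val_inj; rewrite /= -[LHS]odd_double_half oij ij.
exact: odd_double_half.
Qed.

(** Every root of det (A - l B) has an eigenspace of dimension at least 2, and
    distinct eigenspaces are orthogonal for both matrices. *)
Lemma skew_even_normal k (A B : 'M[K]_(k.*2)) (l : 'I_k -> K) :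
    A^T = - A -> B^T = - B -> B \in unitmx -> injective l ->
    (forall p, \det (A - l p *: B) = 0) ->
  exists2 P : 'M_(k.*2), P \in unitmx &
    forall i j, pair_of i != pair_of j ->
      (P *m A *m P^T) i j = 0 /\ (P *m B *m P^T) i j = 0.
Proof.
move=> sA sB uB linj det0.
have /fin_all_exists2[Y fY YE] p :
    exists2 Y : 'M_(2, k.*2), row_free Y & Y *m (A - l p *: B) = 0.
  apply: skew_even_kernel (det0 p); first by rewrite odd_double.
  by rewrite linearB linearZ /= sA sB scalerN opprB opprK addrC.
have {}YE p : Y p *m A = l p *: (Y p *m B).
  by apply/eqP; rewrite -subr_eq0 scalemxAr -mulmxBr YE.
pose e (i : 'I_k.*2) : 'I_2 := inord (odd i).
have eK i : e i = odd i :> nat by rewrite inordK //; case: odd.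
pose P := \matrix_(i < k.*2) row (e i) (Y (pair_of i)).
have cross p q : p != q -> Y p *m B *m (Y q)^T = 0.
  move=> npq; have e1 : Y p *m A *m (Y q)^T = l p *: (Y p *m B *m (Y q)^T).
    by rewrite YE -scalemxAl.
  have e2 : Y p *m A *m (Y q)^T = l q *: (Y p *m B *m (Y q)^T).
    have -> : Y p *m A *m (Y q)^T = - (Y q *m A *m (Y p)^T)^T.
      by rewrite !trmx_mul trmxK sA mulNmx mulmxN opprK mulmxA.
    by rewrite YE -scalemxAl linearZ /= !trmx_mul trmxK sB mulNmx mulmxN scalerN opprK mulmxA.
  move: e1; rewrite e2 => /eqP; rewrite eq_sym -subr_eq0 -scalerBl scaler_eq0 subr_eq0.
  by rewrite (inj_eq linj) (negbTE npq) => /eqP.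
exists P => [|i j nij]; last first.
  have rP a : row a P = row (e a) (Y (pair_of a)) by rewrite rowK.
  have zB : row i P *m B *m (row j P)^T = 0.
    rewrite !rP rowE [row (e j) _]rowE trmx_mul mulmxA -[_ *m Y _ *m B]mulmxA.
    by rewrite -[_ *m (Y _)^T]mulmxA cross // mulmx0 mul0mx.
  split; rewrite mx_row_entry; last by rewrite zB mxE.
  have -> : row i P *m A = l (pair_of i) *: (row i P *m B).
    by rewrite rP -row_mul YE linearZ /= row_mul.
  by rewrite -scalemxAl zB scaler0 mxE.
rewrite -row_free_unit; apply/inj_row_free => u uP.
pose c p : 'rV[K]_2 := \sum_(i | pair_of i == p) u 0 i *: delta_mx 0 (e i).
have cY0 : \sum_p c p *m Y p = 0.
  rewrite -[RHS]uP mulmx_sum_row (partition_big (@pair_of k) xpredT) //=.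
  apply: eq_bigr => p _; rewrite mulmx_suml; apply: eq_bigr => i /eqP <-.
  by rewrite -scalemxAl rowK -rowE.
have c0 p : c p = 0.
  apply/eqP; rewrite -(mulmx_free_eq0 _ (fY p)); apply/eqP.
  apply: (eigenvectors_direct (M := A *m invmx B) linj) cY0 p => q.
  by rewrite -mulmxA [Y q *m _]mulmxA YE -scalemxAl mulmxK // -scalemxAr.
apply/rowP => i; have /rowP/(_ (e i)) := c0 (pair_of i).
rewrite summxE (bigD1 i) //= big1 ?addr0 => [|j /andP[/eqP pij nji]].
  by rewrite !mxE !eqxx mulr1.
rewrite !mxE /=; case: eqVneq => [eij|_]; last by rewrite mulr0.
have oij : odd i = odd j by have := congr1 (@nat_of_ord 2) eij; rewrite !eK; do 2 case: odd.
by rewrite (pair_of_inj (esym pij) oij) eqxx in nji.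
Qed.

End EvenPencils.

(** * Distinct eigenvalues of a generic pencil *)

(** Its rank is at most the number of distinct eigenvalues of M, so a
    nonzero determinant certifies k of them by a polynomial in the entries. *)
Definition trace_hankel (R : pzRingType) n (M : 'M[R]_n) k : 'M[R]_k :=
  \matrix_(i, j) \tr (M ^+ (i + j)%N).

Section DistinctEigenvalues.
Variable K : numClosedFieldType.

Lemma nilpotent_trace n (M : 'M[K]_n.+1) m : M ^+ m = 0 -> \tr M = 0.
Proof.
move=> M0; have [r e] := closed_field_poly_normal (char_poly M).
rewrite (monicP (char_poly_monic M)) scale1r in e.
have r0 z : z \in r -> z = 0.
  move=> zr; have : eigenvalue M z by rewrite eigenvalue_root_char e root_prod_XsubC.
  case/eigenvalueP=> v vM v0; have vMm j : v *m M ^+ j = z ^+ j *: v.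
    elim: j => [|j IH]; first by rewrite !expr0 mulmx1 scale1r.
    by rewrite !exprS -mulmxE mulmxA vM -scalemxAl IH scalerA.
  have /eqP := vMm m; rewrite M0 mulmx0 eq_sym scaler_eq0 (negbTE v0) orbF.
  by rewrite expf_eq0 => /andP[_ /eqP].
have rn : size r = n.+1.
  by have := size_char_poly M; rewrite e size_prod_XsubC => -[].
have eX : char_poly M = 'X^(n.+1).
  rewrite e big_seq (eq_bigr (fun=> 'X)) => [|z /r0 ->]; last by rewrite subr0.
  by rewrite -big_seq big_const_seq count_predT rn iter_mulr_1.
have := char_poly_trace M isT; rewrite eX coefXn /= => /eqP.
by rewrite ltn_eqF // eq_sym oppr_eq0 => /eqP.
Qed.

(** If M had fewer than k eigenvalues z, the product q of the factors X - z
    would have degree less than k and q(M) would be nilpotent, so the traces of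
    all q(M) M^j would vanish: a linear relation between the rows. *)
Lemma hankel_distinct_eigenvalues n (M : 'M[K]_n.+1) k :
    \det (trace_hankel M k) != 0 ->
  exists2 l : 'I_k -> K, injective l & forall p, eigenvalue M (l p).
Proof.
move=> H0; have [r e] := closed_field_poly_normal (char_poly M).
rewrite (monicP (char_poly_monic M)) scale1r in e.
have [ks|sk] := leqP k (size (undup r)).
  exists (fun p : 'I_k => (undup r)`_p) => [p q epq|p].
    apply/val_inj/eqP; have ps := leq_trans (ltn_ord p) ks.
    have qs := leq_trans (ltn_ord q) ks.
    by rewrite -(nth_uniq 0 ps qs (undup_uniq r)) epq.
  rewrite eigenvalue_root_char e root_prod_XsubC -mem_undup.
  by apply: mem_nth; apply: leq_trans ks.
case/negP: H0; apply/det0P; pose q := \prod_(z <- undup r) ('X - z%:P) : {poly K}.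
have qk : (size q <= k)%N by rewrite size_prod_XsubC.
exists (\row_(i < k) q`_i).
  have q1 : q \is monic by apply: monic_prod_XsubC.
  apply: contraNneq (monic_neq0 q1) => /rowP q0; apply/eqP/polyP => i; rewrite coef0.
  have [ik|ki] := ltnP i k; last by rewrite nth_default // (leq_trans qk).
  by have := q0 (Ordinal ik); rewrite !mxE.
have nil : (horner_mx M q) ^+ size r = 0.
  have : char_poly M %| q ^+ size r.
    have sub : {subset r <= r} by [].
    rewrite e; elim: {-2}(r) sub => [|z s IH] sr; first by rewrite big_nil dvd1p.
    rewrite big_cons exprS dvdp_mul ?IH // => [|y ys].
      by rewrite dvdp_XsubCl root_prod_XsubC mem_undup sr ?mem_head.
    by rewrite sr // inE ys orbT.
  case/dvdpP => p; rewrite -rmorphXn => ->.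
  by rewrite rmorphM /= Cayley_Hamilton mulr0.
apply/rowP => j; rewrite !mxE.
transitivity (\tr (horner_mx M (q * 'X^j))).
  have qE : q = \sum_(i < k) q`_i *: 'X^i.
    rewrite -poly_def; apply/polyP => i; rewrite coef_poly.
    by case: ltnP => // ki; rewrite nth_default // (leq_trans qk).
  rewrite [in RHS]qE mulr_suml !rmorph_sum /= linear_sum; apply: eq_bigr => i _ /=.
  rewrite !mxE -scalerAl -exprD -mul_polyC rmorphM /= horner_mx_C rmorphXn /=.
  by rewrite horner_mx_X -mulmxE mul_scalar_mx linearZ.
apply: (@nilpotent_trace _ _ (size r)).
by rewrite -rmorphXn exprMn rmorphM rmorphXn /= nil mul0r.
Qed.

End DistinctEigenvalues.

Section GenericPencil.
Variable n : nat.
Local Notation pair_set := {A : {set 'I_n} | #|A| == 2}.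

Definition gram_mx (R : pzRingType) (c : pair_set -> R) : 'M[R]_n :=
  \matrix_(i, j) if (i < j)%N then oapp c 0 (insub [set i; j])
    else if (j < i)%N then - oapp c 0 (insub [set i; j]) else 0.

Lemma gram_mxE (K : numFieldType) (f : exterior K n) :
  gram f = gram_mx (fun B => ext_coef f (val B)).
Proof.
apply/matrixP => i j; rewrite !mxE.
have c2 : i != j -> #|[set i; j]| == 2 by rewrite cards2 => ->.
by case: ltngtP => // ij; rewrite insubT ?c2 // neq_ltn ij ?orbT.
Qed.

Lemma eq_gram_mx (R : pzRingType) (c c' : pair_set -> R) :
  c =1 c' -> gram_mx c = gram_mx c'.
Proof.
by move=> ec; apply/matrixP => i j; rewrite !mxE; case: insub => //= B; rewrite ec.
Qed.

Lemma map_gram_mx (R S : pzRingType) (phi : {rmorphism R -> S}) c :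
  map_mx phi (gram_mx c) = gram_mx (phi \o c).
Proof.
apply/matrixP => i j; rewrite !mxE.
by case: insub => [B|] /=; case: ifP => _; rewrite ?rmorph0 //; case: ifP => _;
  rewrite ?rmorphN ?rmorph0.
Qed.

Lemma map_trace_hankel (R S : pzRingType) (phi : {rmorphism R -> S}) m (M : 'M[R]_m) k :
  map_mx phi (trace_hankel M k) = trace_hankel (map_mx phi M) k.
Proof.
have mX l : map_mx phi (M ^+ l) = (map_mx phi M) ^+ l.
  by elim: l => [|l IH]; rewrite ?expr0 ?map_mx1 // !exprS -!mulmxE map_mxM IH.
by apply/matrixP => i j; rewrite !mxE -mX trace_map_mx.
Qed.

End GenericPencil.

Section SpecialEvenPencil.
Variable k : nat.
Local Notation n := (k.*2).
Local Notation pair_set := {A : {set 'I_n} | #|A| == 2}.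

(** The pair with g the sum of the x_(2p) x_(2p+1) and f the sum of the
    2 p x_(2p) x_(2p+1). *)
Definition diag_coefs (t : bool * pair_set) : rat :=
  [forall i in val t.2, forall j in val t.2, pair_of i == pair_of j]%:R *
  (if t.1 then (\sum_(i in val t.2) i./2)%:R else 1).

Local Notation F0 := (gram_mx (fun B => diag_coefs (true, B))).
Local Notation G0 := (gram_mx (fun B => diag_coefs (false, B))).

Lemma diag_gramE (b : bool) (i j : 'I_n) :
  gram_mx (fun B => diag_coefs (b, B)) i j =
  (if b then (i./2.*2)%:R else 1) *
    (if pair_of i == pair_of j then (odd j)%:R - (odd i)%:R else 0).
Proof.
have coefE (a c : 'I_n) : a != c ->
    oapp (fun B => diag_coefs (b, B)) 0 (insub [set a; c]) =
    (pair_of a == pair_of c)%:R * (if b then (a./2.*2)%:R else 1).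
  move=> nac; rewrite insubT ?cards2 ?nac //= => H; rewrite /diag_coefs /=.
  have -> : [forall i in [set a; c], forall j in [set a; c], pair_of i == pair_of j]
      = (pair_of a == pair_of c).
    apply/'forall_in_'forall_in_eqP/eqP => [h|e i' + j'].
      by apply: h; rewrite ?set21 ?set22.
    by rewrite !inE => /orP[]/eqP-> /orP[]/eqP->.
  case: eqVneq => [e|_]; rewrite ?mul0r // !mul1r; case: (b) => //.
  by rewrite big_setU1 ?inE // big_set1 /= -(congr1 val e : a./2 = c./2) addnn.
rewrite mxE; have oE (l : 'I_n) := odd_double_half l.
case: ltngtP => [ij|ji|/val_inj->]; last by rewrite eqxx subrr mulr0.
  rewrite coefE ?neq_ltn ?ij // mulrC; congr (_ * _); case: eqVneq => // -[eij].
  have [-> ->] : odd i = false /\ odd j = true; last by rewrite subr0.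
  by have := oE i; have := oE j; rewrite eij; do 2 case: odd; lia.
rewrite coefE ?neq_ltn ?ji ?orbT // mulrC -mulrN; congr (_ * _).
case: eqVneq => [[eij]|]; last by rewrite oppr0.
have [-> ->] : odd i = true /\ odd j = false; last by rewrite sub0r.
by have := oE i; have := oE j; rewrite eij; do 2 case: odd; lia.
Qed.

Lemma diag_gram_mul : F0 = diag_mx (\row_i (i./2.*2)%:R) *m G0.
Proof.
by apply/matrixP => i j; rewrite mul_diag_mx [RHS]mxE !diag_gramE [in RHS]mxE mul1r.
Qed.

Lemma diag_gram_unit : \det G0 != 0.
Proof.
apply/det0P => -[v v0 vG]; case/eqP: v0; apply/rowP => i; rewrite mxE.
have ltj : (i./2.*2 + ~~ odd i < n)%N.
  by have := half_ltn i; case: odd => /=; lia.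
pose j : 'I_n := Ordinal ltj.
have hj : j./2 = i./2 by rewrite /= addnC half_bit_double.
have oj : odd j = ~~ odd i by rewrite /= oddD odd_double oddb.
have pj : pair_of j = pair_of i by apply: val_inj.
have /rowP/(_ j) := vG; rewrite [RHS]mxE [LHS]mxE (bigD1 i) //= big1 ?addr0 => [|l nli].
  rewrite diag_gramE pj eqxx mul1r oj => /eqP; rewrite mulf_eq0 => /orP[/eqP//|].
  by case: odd.
rewrite diag_gramE mul1r; case: eqVneq => [plj|_]; last by rewrite mulr0.
have [olj|] := eqVneq (odd l) (odd j); first by rewrite olj subrr mulr0.
rewrite oj => /eqP oli; case/eqP: nli; apply: pair_of_inj; first by rewrite plj.
by move: oli; do 2 case: odd.
Qed.

(** The product of the two matrices is diagonal with rational entries t_i. A row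
    vector u killed by the Hankel matrix gives a polynomial of degree less than
    k for which the sum of the squares of the values at all t_i vanishes; as
    there are k distinct t_i, it is zero. *)
Lemma diag_hankel : \det (trace_hankel (F0 *m \adj G0) k) != 0.
Proof.
set d := \det G0; pose t (i : 'I_n) : rat := d * (i./2.*2)%:R.
have -> : F0 *m \adj G0 = diag_mx (\row_i t i).
  rewrite diag_gram_mul -mulmxA mul_mx_adj mul_mx_scalar.
  by apply/matrixP => i j; rewrite !mxE mulrnAr.
have diagX m : diag_mx (\row_i t i) ^+ m = diag_mx (\row_i t i ^+ m).
  elim: m => [|m IH].
    by rewrite expr0; apply/matrixP => i j; rewrite !mxE expr0.
  by rewrite exprS IH -mulmxE mulmx_diag; congr diag_mx; apply/rowP => i; rewrite !mxE exprS.
apply/det0P => -[u u0 uH].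
have tE i : (rVpoly u).[t i] = \sum_(a < k) u 0 a * t i ^+ a.
  rewrite (horner_coef_wide _ (size_poly _ _)); apply: eq_bigr => a _.
  by rewrite coef_rVpoly_ord.
(* The sum of squares is the value at u of the quadratic form of the matrix. *)
have sq0 : \sum_i (rVpoly u).[t i] ^+ 2 = 0.
  transitivity (\sum_b (u *m trace_hankel (diag_mx (\row_i t i)) k) 0 b * u 0 b).
    have HE b : (u *m trace_hankel (diag_mx (\row_i t i)) k) 0 b =
        \sum_i (rVpoly u).[t i] * t i ^+ b.
      rewrite mxE; under eq_bigr do rewrite mxE diagX mxtrace_diag mulr_sumr.
      rewrite exchange_big; apply: eq_bigr => i _; rewrite tE mulr_suml.
      by apply: eq_bigr => a _; rewrite mxE exprD mulrA.
    under [RHS]eq_bigr do rewrite HE mulr_suml; rewrite exchange_big.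
    apply: eq_bigr => i _; rewrite expr2 {2}tE mulr_sumr.
    by apply: eq_bigr => b _; rewrite -mulrA; congr (_ * _); rewrite mulrC.
  by rewrite big1 // => b _; rewrite uH mxE mul0r.
have root0 i : root (rVpoly u) (t i).
  have := psumr_eq0P (fun i _ => sqr_ge0 (rVpoly u).[t i]) sq0 => /(_ i isT) /eqP.
  by rewrite sqrf_eq0.
case/eqP: u0; apply/(can_inj (@rVpolyK _ _)); rewrite linear0; apply/eqP.
apply: contraTT isT => pu0.
pose rs := [seq d * (p.*2)%:R | p <- iota 0 k].
have : (size rs < size (rVpoly u))%N.
  apply: max_poly_roots => //.
    apply/allP => z /mapP[p]; rewrite mem_iota /= add0n => pk ->.
    have pn : (p.*2 < n)%N by rewrite ltn_double.
    by have := root0 (Ordinal pn); rewrite /t /= doubleK.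
  rewrite map_inj_uniq ?iota_uniq // => p q /(mulfI diag_gram_unit) /eqP.
  by rewrite eqr_nat => /eqP /double_inj.
by rewrite size_map size_iota ltnNge size_poly.
Qed.

End SpecialEvenPencil.

Section GenericEven.

(** Both conditions are non-vanishing of polynomials in the coefficients, and
    they hold for the diagonal pencil. *)
Lemma generic_even_pencil (K : numFieldType) k (f g : exterior K k.*2) :
    generic_quadratic_pair f g ->
  \det (gram g) != 0 /\ \det (trace_hankel (gram f *m \adj (gram g)) k) != 0.
Proof.
case=> _ _ indep.
pose X b := gram_mx (fun B : {A : {set 'I_k.*2} | #|A| == 2} =>
  'X_(enum_rank (b, B)) : {mpoly rat[#|{: bool * {A : {set 'I_k.*2} | #|A| == 2}}|]}).
have XK b : map_mx (eval_family (quadratic_coefs f g)) (X b) = gram (if b then f else g).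
  rewrite map_gram_mx gram_mxE; apply: eq_gram_mx => B /=.
  by rewrite eval_familyX.
have XQ b : map_mx (meval (fun i => diag_coefs (enum_val i))) (X b) =
    gram_mx (fun B => diag_coefs (b, B)).
  by rewrite map_gram_mx; apply: eq_gram_mx => B /=; rewrite mevalXU enum_rankK.
split.
  rewrite -(XK false); apply: (generic_det_neq0 (q := @diag_coefs k)) => //.
  by rewrite XQ diag_gram_unit.
rewrite -[gram f](XK true) -[gram g](XK false) -map_mx_adj -map_mxM -map_trace_hankel.
apply: (generic_det_neq0 (q := @diag_coefs k)) => //.
by rewrite map_trace_hankel map_mxM map_mx_adj !XQ diag_hankel.
Qed.

Lemma generic_even_normal (K : numClosedFieldType) k (f g : exterior K k.*2) :
    generic_quadratic_pair f g ->
  exists2 P : 'M_(k.*2), P \in unitmx &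
    forall i j, pair_of i != pair_of j ->
      (P *m gram f *m P^T) i j = 0 /\ (P *m gram g *m P^T) i j = 0.
Proof.
move=> /generic_even_pencil[dG dH].
have [l linj leig] : exists2 l : 'I_k -> K, injective l &
    forall p, eigenvalue (gram f *m \adj (gram g)) (l p).
  case: k f g dG dH => [|k] f g dG dH.
    by exists (fun=> 0) => -[].
  exact: hankel_distinct_eigenvalues dH.
apply: (@skew_even_normal _ _ _ _ (fun p => l p / \det (gram g))) => [||||p].
- exact: gram_skew.
- exact: gram_skew.
- by rewrite unitmxE unitfE.
- by move=> p q /(mulIf (invr_neq0 dG)) /linj.
have /eigenvalueP[v vM v0] := leig p.
apply/eqP/det0P; exists v => //; rewrite mulmxBr -scalemxAr.
have /(congr1 (mulmx^~ (gram g))) := vM.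
rewrite -scalemxAl -!mulmxA mul_adj_mx mul_mx_scalar -scalemxAr => e.
by rewrite mulrC -scalerA -e scalerA mulVf // scale1r subrr.
Qed.

End GenericEven.

(** * Dimensions of the annihilators *)

Section Halves.
Variable k : nat.

Lemma point_ltn (p : 'I_k) (b : bool) : (p.*2 + b < k.*2)%N.
Proof. by have := ltn_ord p; case: b; lia. Qed.

Definition pair_point p b : 'I_k.*2 := Ordinal (point_ltn p b).

Lemma pair_pointK p b : (pair_of (pair_point p b) = p) * (odd (pair_point p b) = b).
Proof.
split; first by apply: val_inj; rewrite /= addnC half_bit_double.
by rewrite /= oddD odd_double oddb.
Qed.

Lemma pair_of_pointK (i : 'I_k.*2) : pair_point (pair_of i) (odd i) = i.
Proof. by apply: val_inj; rewrite /= addnC odd_double_half. Qed.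

Definition choice_set (c : {ffun 'I_k -> bool}) : {set 'I_k.*2} :=
  [set pair_point p (c p) | p : 'I_k].

Lemma in_choice_set c i : (i \in choice_set c) = (odd i == c (pair_of i)).
Proof.
apply/imsetP/eqP => [[p _ ->]|e]; first by rewrite !pair_pointK.
by exists (pair_of i); rewrite -?e ?pair_of_pointK.
Qed.

Lemma card_choice_set c : #|choice_set c| = k.
Proof.
rewrite card_imset ?card_ord // => p q e.
by rewrite -(pair_pointK p (c p)) e pair_pointK.
Qed.

Definition choice_sets : {set {set 'I_k.*2}} := [set choice_set c | c : {ffun 'I_k -> bool}].

Lemma card_choice_sets : #|choice_sets| = (2 ^ k)%N.
Proof.
rewrite card_imset ?card_ffun ?card_bool ?card_ord // => c c' e.
apply/ffunP => p; have := in_choice_set c (pair_point p (c p)).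
by rewrite e in_choice_set !pair_pointK eqxx => /eqP.
Qed.

Definition even_pairs : seq ('I_k.*2 * 'I_k.*2) :=
  [seq (pair_point p false, pair_point p true) | p <- enum 'I_k].

Lemma flatten_iota2 a m b :
  flatten [seq [:: p.*2 + b; p.*2.+1 + b]%N | p <- iota a m] = iota (a.*2 + b) m.*2.
Proof. by elim: m a => //= m IH a; rewrite IH doubleS. Qed.

Lemma uniq_even_pairs : uniq (pair_vars even_pairs).
Proof.
rewrite -(map_inj_uniq val_inj) (_ : map _ _ = iota 0 k.*2) ?iota_uniq //.
rewrite -[iota 0 _](flatten_iota2 0 k 0) -val_enum_ord /pair_vars /even_pairs.
by elim: (enum 'I_k) => //= p s ->; rewrite !addn0 addn1.
Qed.

Lemma transversal_choice A : transversal_set even_pairs A -> A \in choice_sets.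
Proof.
case/andP=> _ /allP tA; apply/imsetP; exists [ffun p => pair_point p true \in A] => //.
apply/setP => i; rewrite in_choice_set ffunE -[in LHS](pair_of_pointK i).
have /tA /= : (pair_point (pair_of i) false, pair_point (pair_of i) true) \in even_pairs.
  by apply/mapP; exists (pair_of i); rewrite ?mem_enum.
by case: (odd i); do 2 case: (_ \in A).
Qed.

End Halves.

Lemma pair_form_homog (K : numFieldType) n (c : 'I_n * 'I_n -> K) ps :
  uniq (pair_vars ps) -> pair_form c ps \in ext_homog K n 2.
Proof.
elim: ps => [_|p ps IH]; first by rewrite /pair_form big_nil mem0v.
rewrite /= inE negb_or -!andbA => /and4P[nij _ _ /IH h].
rewrite pair_form_cons rpredD // rpredZ //; apply/mem_ext_homog.
apply: (@ext_suppM _ _ (pred1 [set p.1]) (pred1 [set p.2])).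
- by move=> A B /eqP-> /eqP-> _; rewrite cards2 nij.
- by apply: ext_supp_monom => /=.
- by apply: ext_supp_monom => /=.
Qed.

Section EvenDim.
Variables (K : numClosedFieldType) (k : nat) (f g : exterior K k.*2).
Hypothesis fg : generic_quadratic_pair f g.

Lemma annih_even_le d : (d <= k)%N ->
  (\dim (annih f g d) <= #|[set A in choice_sets k | #|A| == d]|)%N.
Proof.
move=> dk; pose l (p : 'I_k.*2 * 'I_k.*2) : rat := p.1%:R.
pose f0 := pair_form l (even_pairs k).
pose g0 : exterior rat _ := pair_form (fun=> 1) (even_pairs k).
have uE := uniq_even_pairs k.
apply: leq_trans (@generic_dim_annih_le _ _ d f g f0 g0 fg _ _) _.
- exact: pair_form_homog.
- exact: pair_form_homog.
apply: dim_ext_supp_le => u /mem_annih[su fu gu].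
have tu : ext_supp (transversal_set (even_pairs k)) u.
  apply: (@pair_pencil_annih _ _ l) => //.
    move=> _ _ /mapP[p _ ->] /mapP[q _ ->]; rewrite /l /= !addn0 => /eqP.
    by rewrite eqr_nat => /eqP /double_inj /val_inj ->.
  apply: ext_suppW su => A /eqP Ad; rewrite Ad size_map size_enum_ord dk andbT.
  apply/subsetP => i _; apply/flattenP.
  exists [:: pair_point (pair_of i) false; pair_point (pair_of i) true].
    apply/mapP; exists (pair_point (pair_of i) false, pair_point (pair_of i) true) => //.
    by apply/mapP; exists (pair_of i); rewrite ?mem_enum.
  by rewrite !inE; have := pair_of_pointK i; case: (odd i) => ->; rewrite eqxx ?orbT.
by move=> A uA; rewrite !inE (transversal_choice (tu A uA)) (su A uA).
Qed.

(** The coordinates in which both matrices are block diagonal provide one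
    product of k linear forms for each choice set. *)
Lemma dim_annih_even : \dim (annih f g k) = (2 ^ k)%N.
Proof.
apply/eqP; rewrite eqn_leq; apply/andP; split.
  apply: leq_trans (annih_even_le (leqnn k)) _; rewrite -card_choice_sets.
  by apply/subset_leq_card/subsetP => A; rewrite inE => /andP[].
have [P uP PE] := generic_even_normal fg; case: fg => f2 g2 _.
rewrite -card_choice_sets; apply: (annih_ge uP) => // _ /imsetP[c _ ->].
split=> [|i j]; first exact: card_choice_set.
rewrite !in_choice_set => ic jc.
have [pij|] := eqVneq (pair_of i) (pair_of j); last exact: PE.
(* Two indices outside a choice set that lie in the same block are equal. *)
have -> : j = i.
  by apply: pair_of_inj => //; move: ic jc; rewrite pij; case: (odd i); case: (odd j); case: (c _).
by split; rewrite mx_row_entry skew_row_sq ?mxE //; apply: gram_skew.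
Qed.

Lemma dim_annih_even_lt d : (d < k)%N -> \dim (annih f g d) = 0%N.
Proof.
move=> dk; apply/eqP; rewrite -leqn0.
apply: leq_trans (annih_even_le (ltnW dk)) _; rewrite leqn0 cards_eq0 -subset0.
apply/subsetP => A; rewrite inE => /andP[/imsetP[c _ ->]].
by rewrite card_choice_set eq_sym ltn_eqF.
Qed.

End EvenDim.

Section OddDim.
Variables (K : numFieldType) (k : nat) (f g : exterior K k.*2.+1).
Hypothesis fg : generic_quadratic_pair f g.

Definition odd_pairs : seq ('I_k.*2.+1 * 'I_k.*2.+1) :=
  [seq (lift ord0 (pair_point p false), lift ord0 (pair_point p true)) | p <- enum 'I_k].

Lemma perm_odd_pairs : perm_eq (ord0 :: pair_vars odd_pairs) (enum 'I_k.*2.+1).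
Proof.
suff -> : ord0 :: pair_vars odd_pairs = enum 'I_k.*2.+1 by [].
apply: (inj_map val_inj); rewrite val_enum_ord /=; congr (_ :: _).
rewrite -[iota 1 _](flatten_iota2 0 k 1) -val_enum_ord /pair_vars /odd_pairs.
by elim: (enum 'I_k) => //= p s ->; rewrite !addn1 addn0.
Qed.

Let xs : {set 'I_k.*2.+1} := [set i in [seq p.1 | p <- odd_pairs]].

Lemma annih_odd_le d : (d <= k)%N ->
  (\dim (annih f g d) <= #|[set A in [set xs] | #|A| == d]|)%N.
Proof.
move=> dk; pose f0 : exterior rat _ := pair_form (fun=> 1) odd_pairs.
pose g0 : exterior rat _ := pair_form (fun=> 1) (shifted_pairs ord0 odd_pairs).
have uE : uniq (ord0 :: pair_vars odd_pairs) by rewrite (perm_uniq perm_odd_pairs) enum_uniq.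
apply: leq_trans (@generic_dim_annih_le _ _ d f g f0 g0 fg _ _) _.
- by apply: pair_form_homog; case/andP: uE.
- apply: pair_form_homog; case: odd_pairs uE => [|p ps] uE //.
  by move: uE; rewrite -(perm_uniq (perm_shifted_pairs _ _ _)) => /andP[].
apply: dim_ext_supp_le => u /mem_annih[su fu gu].
have tu : ext_supp (pred1 xs) u.
  apply: odd_pencil_annih fu gu => //.
  apply: ext_suppW su => A /eqP Ad; rewrite Ad size_map size_enum_ord dk andbT.
  by apply/subsetP => i _; rewrite (perm_mem perm_odd_pairs) mem_enum.
by move=> A uA; rewrite /= in_set in_set1 (su A uA) andbT; apply: tu uA.
Qed.

Lemma card_odd_xs : #|xs| = k.
Proof.
have ux : uniq [seq p.1 | p <- odd_pairs].
  rewrite -map_comp map_inj_uniq ?enum_uniq // => p q /= /lift_inj e.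
  by rewrite -(pair_pointK p false) e pair_pointK.
by rewrite cardsE (card_uniqP ux) size_map size_map size_enum_ord.
Qed.

(** The k linear forms that vanish on a common isotropic subspace of dimension
    k + 1 have a product in the annihilator. *)
Lemma dim_annih_odd : \dim (annih f g k) = 1%N.
Proof.
apply/eqP; rewrite eqn_leq; apply/andP; split.
  apply: leq_trans (annih_odd_le (leqnn k)) _; rewrite -(cards1 xs).
  by apply/subset_leq_card/subsetP => A; rewrite inE => /andP[].
have [P uP PE] := skew_odd_normal (gram_skew f) (gram_skew g); case: fg => f2 g2 _.
pose T := [set i : 'I_k.*2.+1 | (k < i)%N].
rewrite -(cards1 T); apply: (annih_ge uP) => // _ /set1P ->.
split=> [|i j]; last by rewrite !inE -!leqNgt; apply: PE.
have lt_p (p : 'I_k) : (k.+1 + p < k.*2.+1)%N by have := ltn_ord p; lia.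
have -> : T = [set Ordinal (lt_p p) | p : 'I_k].
  apply/setP => i; rewrite inE; apply/idP/imsetP => [ki|[p _ ->]].
  2: by rewrite /= addSn ltnS leq_addr.
  have ik : (i - k.+1 < k)%N by have := ltn_ord i; lia.
  by exists (Ordinal ik) => //; apply: val_inj; rewrite /= subnKC.
by rewrite card_imset ?card_ord // => p q /(congr1 val) /= /addnI /val_inj.
Qed.

Lemma dim_annih_odd_lt d : (d < k)%N -> \dim (annih f g d) = 0%N.
Proof.
move=> dk; apply/eqP; rewrite -leqn0.
apply: leq_trans (annih_odd_le (ltnW dk)) _; rewrite leqn0 cards_eq0 -subset0.
by apply/subsetP => A; rewrite !inE => /andP[/eqP ->]; rewrite card_odd_xs eq_sym ltn_eqF.
Qed.

End OddDim.

(** * Counting the lattice paths *)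

Section PathCount.
Variables w h : int.
Implicit Types (p : int * int) (m : seq bool).

Definition path_from p m : bool :=
  all (in_rectangle w h) (p :: scanl lattice_move p m) && (foldl lattice_move p m == (w, h)).

Definition count_paths p (L : nat) : nat := #|[set m : L.-tuple bool | path_from p m]|.

Lemma path_from_cons p b m :
  path_from p (b :: m) = in_rectangle w h p && path_from (lattice_move p b) m.
Proof. by rewrite /path_from /= -andbA. Qed.

Lemma count_paths0 p : in_rectangle w h p -> count_paths p 0 = (p == (w, h)).
Proof.
move=> rp; rewrite /count_paths; case: eqVneq => [e|ne].
  rewrite (_ : [set _ | _] = setT) ?cardsT ?card_tuple //.
  by apply/setP => m; rewrite !inE tuple0 /path_from /= rp e eqxx.
rewrite (_ : [set _ | _] = set0) ?cards0 //.
by apply/setP => m; rewrite !inE tuple0 /path_from /= rp (negbTE ne).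
Qed.

Lemma count_paths_out p L : ~~ in_rectangle w h p -> count_paths p L = 0%N.
Proof.
move=> rp; apply/eqP; rewrite cards_eq0; apply/eqP/setP => m.
by rewrite !inE /path_from /= (negbTE rp).
Qed.

Lemma count_pathsS p L : in_rectangle w h p ->
  count_paths p L.+1 =
    (count_paths (lattice_move p true) L + count_paths (lattice_move p false) L)%N.
Proof.
move=> rp; pose S b := [set m : L.-tuple bool | path_from (lattice_move p b) m].
pose A b := [set [tuple of b :: m] | m : L.-tuple bool in S b].
have cA b : #|A b| = #|S b|.
  by apply: card_imset => m m' /(congr1 val) [/val_inj].
rewrite /count_paths -/(S true) -/(S false) -(cA true) -(cA false) -cardsUI.
rewrite [X in (_ + X)%N](_ : _ = 0%N) ?addn0.
  apply: eq_card => m; rewrite in_setU inE; case/tupleP: m => b m.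
  rewrite path_from_cons rp /=; have mA b' : ([tuple of b :: m] \in A b') =
      (b' == b) && path_from (lattice_move p b) m.
    apply/imsetP/andP => [[m' + /(congr1 val) [-> ->]]|[/eqP-> pm]].
      by rewrite inE.
    by exists m; rewrite ?inE.
  by rewrite !mA; case: (b); rewrite ?orbF.
apply/eqP; rewrite cards_eq0 -subset0; apply/subsetP => m.
by rewrite inE => /andP[/imsetP[m1 _ ->] /imsetP[m2 _ /(congr1 val)]].
Qed.

End PathCount.

(** In a strip of width 1 every step is forced. *)
Lemma count_paths_width1 h L (y : int) : 0 <= y -> y + L%:Z = h ->
  (count_paths 1 h (0, y) L = odd L) * (count_paths 1 h (1, y) L = ~~ odd L).
Proof.
elim: L y => [|L IH] y y0 yh.
  by rewrite !count_paths0 /in_rectangle //=; rewrite -yh ?addr0 ?xpair_eqE ?eqxx //; lia.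
have [IH0 IH1] : (count_paths 1 h (0, y + 1) L = odd L) *
    (count_paths 1 h (1, y + 1) L = ~~ odd L) by apply: IH; lia.
rewrite !count_pathsS /lattice_move /=; try by rewrite /in_rectangle /=; lia.
split; first by rewrite IH1 count_paths_out ?addn0 ?negbK // /in_rectangle /=; lia.
by rewrite IH0 count_paths_out // /in_rectangle /=; lia.
Qed.

(** In a strip of width 2 a path is back in the middle after every second step,
    and then has two choices. *)
Lemma count_paths_width2 h L (y : int) : 0 <= y -> y + (L.*2.+1)%:Z = h ->
  count_paths 2 h (1, y) L.*2.+1 = (2 ^ L)%N.
Proof.
elim: L y => [|L IH] y y0 yh.
  rewrite count_pathsS /lattice_move /=; last by rewrite /in_rectangle /=; lia.
  by rewrite !count_paths0 /in_rectangle //=; rewrite -yh ?xpair_eqE ?eqxx //; lia.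
rewrite doubleS count_pathsS /lattice_move /=; last by rewrite /in_rectangle /=; lia.
have -> : count_paths 2 h (1 + 1, y + 1) L.*2.+2 = (2 ^ L)%N.
  rewrite count_pathsS /lattice_move /=; last by rewrite /in_rectangle /=; lia.
  rewrite count_paths_out ?add0n; last by rewrite /in_rectangle /=; lia.
  by rewrite (_ : 1 + 1 - 1 = 1 :> int) // IH //; lia.
have -> : count_paths 2 h (1 - 1, y + 1) L.*2.+2 = (2 ^ L)%N.
  rewrite count_pathsS /lattice_move /=; last by rewrite /in_rectangle /=; lia.
  rewrite [X in (_ + X)%N]count_paths_out ?addn0; last by rewrite /in_rectangle /=; lia.
  by rewrite (_ : 1 - 1 + 1 = 1 :> int) // IH //; lia.
by rewrite addnn expnS mul2n.
Qed.

Lemma num_lattice_pathsE n s :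
  num_lattice_paths n s = count_paths (n%:Z + 2 - 2 * s%:Z) (n%:Z + 2) (0, 0) (n + 2).
Proof. by []. Qed.

Lemma num_lattice_paths_odd k : num_lattice_paths (2 * k + 1) (k + 1) = 1%N.
Proof.
rewrite num_lattice_pathsE (_ : _ - _ = 1); last by lia.
by rewrite (count_paths_width1 _ _).1 //; lia.
Qed.

Lemma num_lattice_paths_neg n s : (n + 2 < 2 * s)%N -> num_lattice_paths n s = 0%N.
Proof.
by move=> ns; rewrite num_lattice_pathsE count_paths_out // /in_rectangle /=; lia.
Qed.

Lemma num_lattice_paths_even k : num_lattice_paths (2 * k) k = (2 ^ k)%N.
Proof.
rewrite num_lattice_pathsE (_ : _ - _ = 2); last by lia.
rewrite addn2 count_pathsS; last by rewrite /in_rectangle /=; lia.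
rewrite /lattice_move /= [X in (_ + X)%N]count_paths_out ?addn0 //.
by rewrite -[(2 * k)%N]/(k + (k + 0))%N addn0 addnn count_paths_width2 //; lia.
Qed.

Lemma num_lattice_paths_even_next k : num_lattice_paths (2 * k) (k + 1) = 0%N.
Proof.
rewrite num_lattice_pathsE (_ : _ - _ = 0); last by lia.
rewrite addn2 count_pathsS; last by rewrite /in_rectangle /=; lia.
by rewrite !count_paths_out // /in_rectangle /=; lia.
Qed.

(** * Dimensions of the quotient by a generic pencil *)

Theorem proposition6 (R : realType) (n : nat) (n_gt0 : (0 < n)%N)
    (f g : exterior R[i] n) (fg_generic : generic_quadratic_pair f g) :
  (forall k : nat, n = (2 * k + 1)%N ->
     [/\ \dim (quot_homog [:: f; g] (k + 1)) = num_lattice_paths (2 * k + 1) (k + 1),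
         num_lattice_paths (2 * k + 1) (k + 1) = 1%N,
         \dim (quot_homog [:: f; g] (k + 2)) = num_lattice_paths (2 * k + 1) (k + 2)
       & num_lattice_paths (2 * k + 1) (k + 2) = 0%N]) /\
  (forall k : nat, n = (2 * k)%N ->
     [/\ \dim (quot_homog [:: f; g] k) = num_lattice_paths (2 * k) k,
         num_lattice_paths (2 * k) k = (2 ^ k)%N,
         \dim (quot_homog [:: f; g] (k + 1)) = num_lattice_paths (2 * k) (k + 1)
       & num_lattice_paths (2 * k) (k + 1) = 0%N]).
Proof.
have [f2 g2 _] := fg_generic.
split=> k nk.
  rewrite num_lattice_paths_odd (num_lattice_paths_neg (s := k + 2)); last by lia.
  have nk2 : n = k.*2.+1 by lia.
  split=> //; move: nk2 n_gt0 f g fg_generic f2 g2 {nk} => -> n_gt0 f g fg f2 g2.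
    rewrite dim_quot_homog //; last by lia.
    by rewrite (_ : k.*2.+1 - (k + 1) = k)%N ?dim_annih_odd //; lia.
  have [k0|k_gt0] := posnP k.
    (* For n = 1 the degree k + 2 exceeds n. *)
    have := limg_ker_dim (linfun (@quot_proj _ _ [:: f; g])) (ext_homog _ k.*2.+1 (k + 2)).
    by rewrite dim_ext_homog bin_small ?k0 // => /eqP; rewrite addn_eq0 => /andP[_ /eqP].
  rewrite dim_quot_homog //; last by lia.
  by rewrite dim_annih_odd_lt //; lia.
rewrite num_lattice_paths_even num_lattice_paths_even_next.
have nk2 : n = k.*2 by lia.
split=> //; move: nk2 n_gt0 f g fg_generic f2 g2 {nk} => -> n_gt0 f g fg f2 g2.
  rewrite dim_quot_homog //; last by lia.
  by rewrite (_ : k.*2 - k = k)%N ?dim_annih_even //; lia.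
rewrite dim_quot_homog //; last by lia.
by rewrite dim_annih_even_lt //; lia.
Qed.
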